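(* For metric uniform MLUFL and any $\alpha,\beta\in(0,1)$, one can obtain (in polynomial time) a solution of cost at most $$\max\left\{\frac{\ln(1/\beta)}{1-\beta},\ \frac{3}{1-\beta}+\frac{2}{1-\alpha},\ \frac{4}{\alpha}\left\lceil\frac1\alpha\right\rceil\right\}\cdot\mathrm{OPT},$$ where $\mathrm{OPT}$ is the optimal value of the linear program (Unif-P) of the context. Thus, taking $\alpha=0.7426$, $\beta=0.000021$, one obtains a $10.773$-approximation algorithm for metric uniform MLUFL.
   Context: Uniform MLUFL: we are given a set $\mathcal F$ of $n$ facilities with opening costs $f_i\ge 0$, a set $\mathcal D$ of clients, connection costs $c_{ij}\ge0$ ($i\in\mathcal F$, $j\in\mathcal D$), and a root $r$, with the uniform time metric $d_{uv}=1$ for all distinct $u,v\in\mathcal F\cup\{r\}$. A solution opens a set $F\subseteq\mathcal F$, orders $F$ (a path from $r$ through $F$), and assigns each client $j$ to some $\phi(j)\in F$; its cost is $\sum_{i\in F}f_i+\sum_j\bigl(c_{\phi(j)j}+\pi(\phi(j))\bigr)$, where $\pi(i)\in\{1,2,\dots\}$ is the position of $i$ in the ordering. It is called metric uniform MLUFL when the connection costs come from a metric $c$ on $\mathcal F\cup\mathcal D$. (Unif-P) is the linear program, with $t$ ranging over $\{1,\dots,n\}$: minimize $\sum_{i,t}f_iy_{i,t}+\sum_{j,i,t}(c_{ij}+t)x_{ij,t}$ subject to $\sum_{i,t}x_{ij,t}\ge1$ for all $j$; $x_{ij,t}\le y_{i,t}$ for all $i,j,t$; $\sum_iy_{i,t}\le1$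 for all $t$; $x_{ij,t},y_{i,t}\ge0$ for all $i,j,t$. *)

(* Defs.v *)
From HB Require Import structures.
From mathcomp Require Import all_boot all_order all_algebra.
From mathcomp Require Import all_classical all_reals all_analysis.

Set Implicit Arguments.
Unset Strict Implicit.
Unset Printing Implicit Defensive.

Import Order.TTheory GRing.Theory Num.Theory.
Local Open Scope classical_set_scope.
Local Open Scope ring_scope.

(** * Uniform MLUFL *)

(* Facilities are indexed by 'I_n and clients by 'I_m.  The time metric is
   identically 1 on distinct points, so it is not part of the data: the k-th
   facility on a path from the root is reached at time k. *)
Record mlufl (K : Type) (n m : nat) := Mlufl {
  open_cost : 'I_n -> K;
  conn_cost : 'I_n -> 'I_m -> K }.

(* The connection costs are the facility-client distances of some (pseudo)metric
   on the disjoint union of facilities and clients; distinct points may be at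
   distance 0. *)
Definition metric_mlufl (K : numDomainType) (n m : nat) (I : mlufl K n m) :=
  [/\ forall i, 0 <= open_cost I i,
      forall i j, 0 <= conn_cost I i j &
      exists d : 'I_n + 'I_m -> 'I_n + 'I_m -> K,
        [/\ forall u v, 0 <= d u v,
            forall u, d u u = 0,
            forall u v, d u v = d v u,
            forall u v w, d u w <= d u v + d v w &
            forall i j, d (inl i) (inr j) = conn_cost I i j]].

(* [route] lists the opened facilities in the order in which they are visited. *)
Record solution (n m : nat) := Solution {
  route : seq 'I_n;
  assign : 'I_m -> 'I_n;
  route_uniq : uniq route;
  assign_opened : forall j, assign j \in route }.

Definition position n m (S : solution n m) (i : 'I_n) : nat :=
  (index i (route S)).+1.

Definition cost (K : numDomainType) n m (I : mlufl K n m) (S : solution n m) : K :=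
  \sum_(i <- route S) open_cost I i +
  \sum_(j < m) (conn_cost I (assign S j) j + (position S (assign S j))%:R).

(** * The linear program (Unif-P) *)

(* Time slot t in {1, ..., n} is represented by the ordinal t - 1 : 'I_n. *)
Record lp_point (K : Type) (n m : nat) := LPPoint {
  lp_x : 'I_n -> 'I_m -> 'I_n -> K;
  lp_y : 'I_n -> 'I_n -> K }.

Definition lp_feasible (K : numDomainType) n m (z : lp_point K n m) :=
  [/\ forall j, 1 <= \sum_i \sum_t lp_x z i j t,
      forall i j t, lp_x z i j t <= lp_y z i t,
      forall t, \sum_i lp_y z i t <= 1,
      forall i j t, 0 <= lp_x z i j t &
      forall i t, 0 <= lp_y z i t].

Definition lp_value (K : numDomainType) n m (I : mlufl K n m)
    (z : lp_point K n m) : K :=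
  \sum_i \sum_t open_cost I i * lp_y z i t +
  \sum_j \sum_i \sum_(t < n) (conn_cost I i j + t.+1%:R) * lp_x z i j t.

Definition lp_opt (R : realType) n m (I : mlufl R n m) : R :=
  inf [set lp_value I z | z in [set z | lp_feasible z]].

Definition approx_ratio (R : realType) (a b : R) : R :=
  Num.max (ln (1 / b) / (1 - b))
    (Num.max (3 / (1 - b) + 2 / (1 - a))
             (4 / a * (Num.ceil (1 / a))%:~R)).

(** * Polynomial time: random access machines with logarithmic cost *)

(* Structured programs for a random access machine with integer registers
   indexed by integers (the machine of Aho, Hopcroft and Ullman, with loops in
   place of jumps).  Every operation is charged the bit lengths of all the
   integers it handles, addresses included, so that polynomial time here is
   polynomial time on Turing machines. *)
Inductive expr :=
| Const of int
| Read of expr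
| Add of expr & expr
| Sub of expr & expr
| Mul of expr & expr
| Div of expr & expr.

Inductive program :=
| Skip
| Store of expr & expr
| Seq of program & program
| If of expr & program & program
| While of expr & program.

Definition memory := int -> int.

Definition bits (z : int) : nat := (trunc_log 2 `|z|%N).+1.

Fixpoint eval (s : memory) (e : expr) : int :=
  match e with
  | Const k => k
  | Read e => s (eval s e)
  | Add e1 e2 => eval s e1 + eval s e2
  | Sub e1 e2 => eval s e1 - eval s e2
  | Mul e1 e2 => eval s e1 * eval s e2
  | Div e1 e2 => divz (eval s e1) (eval s e2)
  end.

Fixpoint eval_time (s : memory) (e : expr) : nat :=
  match e with
  | Const k => bits k
  | Read e1 => eval_time s e1 + bits (eval s e1) + bits (eval s e)
  | Add e1 e2 | Sub e1 e2 | Mul e1 e2 | Div e1 e2 =>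
      eval_time s e1 + eval_time s e2 + bits (eval s e1) + bits (eval s e2)
  end%N.

Definition update (s : memory) (a v : int) : memory :=
  fun a' => if a' == a then v else s a'.

(* [exec P s T s'] : started in s, the program P halts in s' after time T.
   A test of e succeeds when e is positive. *)
Inductive exec : program -> memory -> nat -> memory -> Prop :=
| exec_skip s : exec Skip s 1 s
| exec_store a e s :
    exec (Store a e) s
      (eval_time s a + eval_time s e + bits (eval s a) + bits (eval s e))%N
      (update s (eval s a) (eval s e))
| exec_seq P Q s s' s'' T T' :
    exec P s T s' -> exec Q s' T' s'' -> exec (Seq P Q) s (T + T')%N s''
| exec_if_true e P Q s s' T :
    0 < eval s e -> exec P s T s' ->
    exec (If e P Q) s (eval_time s e + bits (eval s e) + T)%N s'
| exec_if_false e P Q s s' T :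
    eval s e <= 0 -> exec Q s T s' ->
    exec (If e P Q) s (eval_time s e + bits (eval s e) + T)%N s'
| exec_while_true e P s s' s'' T T' :
    0 < eval s e -> exec P s T s' -> exec (While e P) s' T' s'' ->
    exec (While e P) s (eval_time s e + bits (eval s e) + T + T')%N s''
| exec_while_false e P s :
    eval s e <= 0 ->
    exec (While e P) s (eval_time s e + bits (eval s e))%N s.

Definition load (w : seq int) : memory :=
  fun a => if a is Posz k then nth 0 w k else 0.

Definition shows (s : memory) (w : seq int) : Prop :=
  forall k : nat, (k < size w)%N -> s k%:Z = nth 0 w k.

Definition rat_code (q : rat) : seq int := [:: numq q; denq q].

Definition mlufl_code n m (I : mlufl rat n m) : seq int :=
  [:: n%:Z, m%:Z &
      flatten [seq rat_code (open_cost I i) | i <- enum 'I_n] ++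
      flatten [seq rat_code (conn_cost I i j) | i <- enum 'I_n, j <- enum 'I_m]].

Definition solution_code n m (S : solution n m) : seq int :=
  (size (route S))%:Z ::
    [seq (val i)%:Z | i <- route S] ++ [seq (val (assign S j))%:Z | j <- enum 'I_m].

Definition code_size (w : seq int) : nat := (\sum_(z <- w) bits z)%N.

(* On every metric instance with rational costs and at least one facility, P
   outputs in polynomial time a solution that is good for this instance. *)
Definition poly_time_solver (P : program)
    (good : forall n m : nat, mlufl rat n m -> solution n m -> Prop) : Prop :=
  exists a k : nat, forall (n m : nat) (I : mlufl rat n m),
    (0 < n)%N -> metric_mlufl I ->
    exists (T : nat) (s : memory) (S : solution n m),
      [/\ exec P (load (mlufl_code I)) T s,
          (T <= a * (code_size (mlufl_code I)) ^ k)%N,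
          shows s (solution_code S) &
          good n m I S].

Definition real_mlufl (R : realType) n m (I : mlufl rat n m) : mlufl R n m :=
  Mlufl (fun i => ratr (open_cost I i)) (fun i j => ratr (conn_cost I i j)).

Definition approximation_algorithm (R : realType) (rho : R) (P : program) : Prop :=
  poly_time_solver P (fun n m I S => forall S' : solution n m,
    cost (real_mlufl R I) S <= rho * cost (real_mlufl R I) S').

(* Main.v *)
Require Import Defs.
From mathcomp Require Import all_boot all_order all_algebra.
From mathcomp Require Import zify lra ring.

Set Implicit Arguments.
Unset Strict Implicit.
Unset Printing Implicit Defensive.

Import Order.TTheory GRing.Theory Num.Theory.
Local Open Scope ring_scope.

(* A greedy algorithm in the style of Jain, Mahdian and Saberi has cost at most
   27/5 times the LP optimum, while the ratio of the theorem is never below 8.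
   Each round assigns a star, that is a facility together with the nearest
   unassigned clients, of smallest average cost; opening a facility costs, in addition to f_i,
   one unit per unassigned client, because it delays all of them.  If
   a_j is the largest average cost met up to the assignment of client j, then
   the cost is at most \sum_j a_j, and a_j / 3 together with
   theta_t = 4/9 #|{j | a_j > 3 t}| is feasible for the dual of (Unif-P), whose value is
   then 1/3 - 4/27 = 5/27 of \sum_j a_j.  So no LP has to be solved: the program
   runs the greedy algorithm on costs scaled to integers by the product of all
   denominators. *)

(** * Dual fitting *)

(** The constants come from one optimisation. If the levels a_j are scaled by x in place of 1/3, and
    slot t counts the clients with a_j > t / x, then the triangle inequality forces the factor x +
    x^2 on theta_t, and the theta_t sum to at most (x^2 + x^3) \sum_j a_j. The dual value is x - x^2
    - x^3 times \sum_j a_j, which is largest at x = 1/3. The running maximum is needed because the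
    smallest average cost may drop from one round to the next: the delay charge shrinks with the
    number of unassigned clients. With monotone levels, the clients l with a_l >= a_j are exactly
    those unassigned at the start of the round in which the level first reached a_j, so the delay
    charge of that round is a count of levels, which theta_t can absorb. *)

Lemma weak_duality (K : realFieldType) n m (I : mlufl K n m) (z : lp_point K n m)
    (u : 'I_m -> K) (th : 'I_n -> K) :
  lp_feasible z -> (forall j, 0 <= u j) -> (forall t, 0 <= th t) ->
  (forall i (t : 'I_n), \sum_j Num.max 0 (u j - (conn_cost I i j + t.+1%:R))
     <= open_cost I i + th t) ->
  \sum_j u j <= lp_value I z + \sum_t th t.
Proof.
case=> hcov hxy hy hx0 hy0 u0 th0 hd.
(* [v] is the least feasible value of the dual variable of x_{ij,t} <= y_{i,t}, which is thereby
   eliminated. *)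
pose v i j (t : 'I_n) := Num.max 0 (u j - (conn_cost I i j + t.+1%:R)).
have v0 i j t : 0 <= v i j t by rewrite /v le_max lexx.
apply: (@le_trans _ _ (\sum_j \sum_i \sum_(t < n) ((conn_cost I i j + t.+1%:R) * lp_x z i j t
    + lp_y z i t * v i j t))).
  apply: ler_sum => j _; apply: (@le_trans _ _ (u j * \sum_i \sum_t lp_x z i j t)).
    by rewrite ler_peMr.
  rewrite mulr_sumr; apply: ler_sum => i _; rewrite mulr_sumr; apply: ler_sum => t _.
  have : u j * lp_x z i j t <= (conn_cost I i j + t.+1%:R) * lp_x z i j t + lp_x z i j t * v i j t.
    rewrite [_ * v _ _ _]mulrC -mulrDl ler_wpM2r //.
    by rewrite -lerBlDl /v le_max lexx orbT.
  move/le_trans; apply; rewrite lerD2l ler_wpM2r //.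
rewrite (eq_bigr (fun j => \sum_i \sum_(t < n) (conn_cost I i j + t.+1%:R) * lp_x z i j t
  + \sum_i \sum_t lp_y z i t * v i j t)); last first.
  by move=> j _; rewrite -big_split /=; apply: eq_bigr => i _; rewrite -big_split.
rewrite big_split /= /lp_value [leRHS]addrAC addrC lerD2r.
rewrite exchange_big /=.
apply: (@le_trans _ _ (\sum_i \sum_t (open_cost I i * lp_y z i t + lp_y z i t * th t))).
  apply: ler_sum => i _; rewrite exchange_big; apply: ler_sum => t _ /=.
  by rewrite -mulr_sumr [_ * lp_y _ _ _]mulrC -mulrDr ler_wpM2l // hd.
rewrite (eq_bigr (fun i => \sum_t open_cost I i * lp_y z i t + \sum_t lp_y z i t * th t));
  last by move=> i _; rewrite big_split.
rewrite big_split lerD2l /= exchange_big; apply: ler_sum => t _ /=.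
by rewrite -mulr_suml ler_piMl.
Qed.

(** This bounds the total of the theta_t: client j is counted in the slots t with 3 t < a_j, of
    which there are at most a_j / 3. *)
Lemma sum_multiples_lt (K : realFieldType) (n : nat) (a : K) : 0 <= a ->
  \sum_(t < n) (3 * t.+1%:R < a)%R%:R <= a / 3.
Proof.
move=> a0; elim: n => [|n IH]; first by rewrite big_ord0; lra.
case: (ltP (3 * n.+1%:R) a) => h.
  apply: (@le_trans _ _ (\sum_(t < n.+1) (1 : K))).
    by apply: ler_sum => t _; case: (_ < _).
  by rewrite sumr_const card_ord -[_ *+ _]/(n.+1%:R); lra.
by rewrite big_ord_recr /= ltNge h addr0.
Qed.

(** All that dual fitting needs from the greedy run. The second property is the minimality of the
    star chosen when the level reached a_j, the cardinality being the delay charge. The third is the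
    triangle inequality through the facility that serves l. *)
Definition dual_certificate (K : realFieldType) n m (I : mlufl K n m) (a : 'I_m -> K) :=
  [/\ forall j, 0 <= a j,
      forall i j (B : {set 'I_m}), (forall l, l \in B -> a j <= a l) ->
        \sum_(l in B) (a j - conn_cost I i l)
          <= open_cost I i + #|[set l | a j <= a l]|%:R &
      forall i j l, a j <= a l + conn_cost I i l + conn_cost I i j].

(* For the clients that contribute to facility i in slot t, the second property
   bounds all a j by multiples of the smallest one, and the first property is
   applied at that smallest level only. *)
Lemma dual_certificate_constraint (K : realFieldType) n m (I : mlufl K n m)
    (a : 'I_m -> K) i (t : 'I_n) :
  metric_mlufl I -> dual_certificate I a ->
  \sum_j Num.max 0 (a j / 3 - (conn_cost I i j + t.+1%:R))
     <= open_cost I i + 4 / 9 * #|[set j | 3 * t.+1%:R < a j]|%:R.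
Proof.
case=> f0 c0 _ [a0 C1 C2].
pose P := [set j | 3 * (conn_cost I i j + t.+1%:R) < a j].
have -> : \sum_j Num.max 0 (a j / 3 - (conn_cost I i j + t.+1%:R)) =
    \sum_(j in P) (a j / 3 - (conn_cost I i j + t.+1%:R)).
  rewrite (bigID (mem P)) /= [X in _ + X]big1 ?addr0.
    by apply: eq_bigr => j; rewrite inE => h; apply/max_idPr; lra.
  by move=> j; rewrite inE -leNgt => h; apply/max_idPl; lra.
have [->|[j0 j0P]] := set_0Vmem P.
  by rewrite big_set0 addr_ge0 // mulr_ge0 // divr_ge0.
pose l := [arg min_(x < j0 in P) a x]%O.
have [lP lmin] : l \in P /\ forall x, x \in P -> a l <= a x.
  by rewrite /l; case: arg_minP.
have hl : 3 * (conn_cost I i l + t.+1%:R) < a l by move: lP; rewrite inE.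
(* 4/9 is 1/3 + 1/9: the third property bounds a_j / 3 by (a_l + c_il + c_ij) / 3, and c_il / 3 <
   a_l / 9 because l is in [P]. *)
apply: (@le_trans _ _ (4 / 9 * \sum_(j in P) (a l - conn_cost I i j))).
  rewrite mulr_sumr; apply: ler_sum => j jP.
  have := C2 i j l; have := c0 i j; have : 0 <= t.+1%:R :> K by []. lra.
have := C1 i l P lmin.
have : #|[set x | a l <= a x]|%:R <= #|[set j | 3 * t.+1%:R < a j]|%:R :> K.
  rewrite ler_nat; apply/subset_leq_card/subsetP => x; rewrite !inE => h.
  by have := c0 i l; lra.
by have := f0 i; lra.
Qed.

Lemma dual_certificate_bound (K : realFieldType) n m (I : mlufl K n m)
    (a : 'I_m -> K) (z : lp_point K n m) :
  metric_mlufl I -> dual_certificate I a -> lp_feasible z ->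
  \sum_j a j <= 27 / 5 * lp_value I z.
Proof.
move=> hI hc hz; have [a0 _ _] := hc.
have W : \sum_j a j / 3 <= lp_value I z
    + \sum_(t < n) 4 / 9 * #|[set j | 3 * t.+1%:R < a j]|%:R.
  apply: (weak_duality hz) => [j|t|i t]; first by rewrite divr_ge0.
    by rewrite mulr_ge0 // divr_ge0.
  exact: dual_certificate_constraint.
move: W; rewrite -mulr_suml -mulr_sumr.
have : \sum_(t < n) #|[set j | 3 * t.+1%:R < a j]|%:R <= (\sum_j a j) / 3.
  rewrite mulr_suml (eq_bigr (fun t : 'I_n => \sum_j (3 * t.+1%:R < a j)%R%:R)); last first.
    move=> t _; rewrite cardsE -sum1_card natr_sum big_mkcond /=.
    by apply: eq_bigr => j _; rewrite (_ : (j \in _) = (3 * t.+1%:R < a j)) //; case: ltP.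
  rewrite exchange_big; apply: ler_sum => j _; exact: sum_multiples_lt.
lra.
Qed.

(** * The greedy algorithm *)

Section Greedy.
Context {K : realFieldType} {n m : nat}.
Implicit Types (I : mlufl K n m) (r : seq 'I_n) (phi : 'I_m -> option 'I_n).

Definition unassigned phi : {set 'I_m} := [set j | phi j == None].

(* Opening one more facility delays every client that is still unassigned by
   one time unit; this delay is added to the opening cost. *)
Definition delayed_cost I r phi i : K :=
  if i \in r then 0 else open_cost I i + #|unassigned phi|%:R.

(** Stars are indexed by a farthest client l, ties included. A set of smallest average cost can be
    taken of this form, so n m candidates suffice. *)
Definition star I phi i l : {set 'I_m} :=
  [set j in unassigned phi | conn_cost I i j <= conn_cost I i l].

Definition star_cost I r phi i l : K :=
  delayed_cost I r phi i + \sum_(j in star I phi i l) conn_cost I i j.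

(** Averages are compared by cross-multiplication, the form in which the integer program tests
    them. *)
Definition best_star I r phi i l := l \in unassigned phi /\
  forall i' l', l' \in unassigned phi ->
    star_cost I r phi i l * #|star I phi i' l'|%:R
      <= star_cost I r phi i' l' * #|star I phi i l|%:R.

Definition next_route r i := if i \in r then r else rcons r i.

Definition next_assign I phi i l : 'I_m -> option 'I_n :=
  fun j => if j \in star I phi i l then Some i else phi j.

(* a j is the largest ratio of a star chosen up to the round in which j gets
   assigned, and tau is the largest ratio so far.  The left-hand side of
   [inv_paid] charges a time unit to each unassigned client for each opened facility. *)
Record greedy_inv I r phi (a : 'I_m -> K) (tau : K) : Prop := GreedyInv {
  inv_uniq : uniq r;
  inv_opened : forall i j, phi j = Some i -> i \in r;
  inv_ge0 : forall j, 0 <= a j;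
  inv_tau_ge0 : 0 <= tau;
  inv_le : forall j, a j <= tau;
  inv_unassigned : forall j, j \in unassigned phi -> a j = tau;
  inv_conn : forall i j, phi j = Some i -> conn_cost I i j <= a j;
  inv_star : forall i j (B : {set 'I_m}), (forall l, l \in B -> a j <= a l) ->
    \sum_(l in B) (a j - conn_cost I i l)
      <= open_cost I i + #|[set l | a j <= a l]|%:R;
  inv_metric : forall i j l, a j <= a l + conn_cost I i l + conn_cost I i j;
  inv_paid : \sum_(i <- r) open_cost I i +
    \sum_j (if phi j is Some i then conn_cost I i j + (index i r).+1%:R
            else (size r)%:R)
    <= \sum_j (if phi j is Some _ then a j else 0) }.

Lemma mem_star I phi i l : l \in unassigned phi -> l \in star I phi i l.
Proof. by rewrite !inE lexx andbT. Qed.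

Lemma card_star_gt0 I phi i l :
  l \in unassigned phi -> 0 < #|star I phi i l|%:R :> K.
Proof. by move=> lU; rewrite ltr0n; apply/card_gt0P; exists l; exact: mem_star. Qed.

Lemma star_sub I phi i l : star I phi i l \subset unassigned phi.
Proof. by apply/subsetP => j; rewrite inE => /andP[]. Qed.

Lemma delayed_cost_ge0 I r phi i : metric_mlufl I -> 0 <= delayed_cost I r phi i.
Proof. by case=> f0 _ _; rewrite /delayed_cost; case: ifP => // _; rewrite addr_ge0. Qed.

Lemma delayed_cost_le I r phi i : metric_mlufl I ->
  delayed_cost I r phi i <= open_cost I i + #|unassigned phi|%:R.
Proof. by case=> f0 _ _; rewrite /delayed_cost; case: ifP => // _; rewrite addr_ge0. Qed.

Definition ratio I r phi i l : K := star_cost I r phi i l / #|star I phi i l|%:R.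

Lemma ratio_card I r phi i l : l \in unassigned phi ->
  ratio I r phi i l * #|star I phi i l|%:R = star_cost I r phi i l.
Proof. by move=> lU; rewrite /ratio divfK // lt0r_neq0 // card_star_gt0. Qed.

Lemma best_ratio_le I r phi i l i' l' :
  best_star I r phi i l -> l' \in unassigned phi ->
  ratio I r phi i l * #|star I phi i' l'|%:R <= star_cost I r phi i' l'.
Proof.
move=> [lU hb] l'U; rewrite -(ler_pM2r (card_star_gt0 I i lU)).
by rewrite mulrAC ratio_card // hb.
Qed.

(** Minimality over stars extends to arbitrary sets [B] of unassigned clients: dropping the clients
    farther than the ratio removes negative terms, and completing the rest to the star of its
    farthest client [k] adds nonnegative ones. *)
Lemma best_ratio_sum_le I r phi i l i' (B : {set 'I_m}) :
  metric_mlufl I -> best_star I r phi i l -> B \subset unassigned phi ->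
  \sum_(j in B) (ratio I r phi i l - conn_cost I i' j) <= delayed_cost I r phi i'.
Proof.
move=> hI hb hB; set rho := ratio _ _ _ _ _.
pose P := [set j in B | conn_cost I i' j <= rho].
have [P0|[j0 j0P]] := set_0Vmem P.
  apply: le_trans (delayed_cost_ge0 r phi i' hI); apply: sumr_le0 => j jB.
  have /negbT : j \in P = false by rewrite P0 inE.
  by rewrite inE jB /= -ltNge subr_le0 => /ltW.
pose k := [arg max_(x > j0 in P) conn_cost I i' x]%O.
have [kP kmax] : k \in P /\ forall x, x \in P -> conn_cost I i' x <= conn_cost I i' k.
  by rewrite /k; case: arg_maxP.
have [kB krho] : k \in B /\ conn_cost I i' k <= rho by move: kP; rewrite inE => /andP.
have kU : k \in unassigned phi by apply: (subsetP hB).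
have := best_ratio_le i' hb kU; rewrite -/rho /star_cost -lerBlDr; apply: le_trans.
have -> : rho * #|star I phi i' k|%:R - \sum_(j in star I phi i' k) conn_cost I i' j =
   \sum_(j in star I phi i' k) (rho - conn_cost I i' j).
  by rewrite sumrB sumr_const mulr_natr.
rewrite big_mkcond [leRHS]big_mkcond; apply: ler_sum => j _.
rewrite [j \in star _ _ _ _]inE.
have [jB|_] := boolP (j \in B); last first.
  by case: ifP => // /andP[_ h]; rewrite subr_ge0 (le_trans h).
rewrite (subsetP hB) //=; have [jP|] := boolP (j \in P); first by rewrite kmax.
by rewrite inE jB /= -ltNge => h; case: ifP => // _; rewrite subr_le0 ltW.
Qed.

(** Removing j from a best star cannot lower its average cost, so j itself costs at most the
    average. *)
Lemma best_conn_le I r phi i l j :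
  metric_mlufl I -> best_star I r phi i l -> j \in star I phi i l ->
  conn_cost I i j <= ratio I r phi i l.
Proof.
move=> hI hb jS; have [lU _] := hb.
have := best_ratio_sum_le i hI hb (subset_trans (subsetDl _ [set j]) (star_sub I phi i l)).
have -> : delayed_cost I r phi i =
    \sum_(k in star I phi i l) (ratio I r phi i l - conn_cost I i k).
  by rewrite sumrB sumr_const -[_ *+ #|_|]mulr_natr ratio_card // addrK.
by rewrite (big_setD1 j jS) /=; lra.
Qed.

(** An open facility has delayed cost 0, so the average of its star at j is at most its farthest
    connection cost, that of j. *)
Lemma best_ratio_opened I r phi i l i' j :
  best_star I r phi i l -> i' \in r -> j \in unassigned phi ->
  ratio I r phi i l <= conn_cost I i' j.
Proof.
move=> hb i'r jU; rewrite -(ler_pM2r (card_star_gt0 I i' jU)).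
apply: le_trans (best_ratio_le i' hb jU) _.
rewrite /star_cost /delayed_cost i'r add0r mulr_natr -sumr_const.
by apply: ler_sum => k; rewrite inE => /andP[].
Qed.

Lemma next_assign_unassigned I phi i l :
  unassigned (next_assign I phi i l) = unassigned phi :\: star I phi i l.
Proof.
by apply/setP => j; rewrite !inE /next_assign !inE; do 2!case: ifP => //.
Qed.

Lemma unassigned_next_lt I phi i l : l \in unassigned phi ->
  (#|unassigned (next_assign I phi i l)| < #|unassigned phi|)%N.
Proof.
move=> lU; rewrite next_assign_unassigned; apply: proper_card.
rewrite properE subsetDl; apply/subsetPn; exists l => //.
by rewrite inE mem_star.
Qed.

Lemma greedy_inv_init I : metric_mlufl I ->
  greedy_inv I [::] (fun=> None) (fun=> 0) 0.
Proof.
case=> f0 c0 _; split=> //.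
- move=> i j B _; apply: (@le_trans _ _ 0); last by rewrite addr_ge0.
  by apply: sumr_le0 => l _; rewrite sub0r oppr_le0.
- by move=> i j l; rewrite add0r addr_ge0.
- by rewrite big_nil add0r lexx.
Qed.

(** The walk from i' through l and i to j; through this inequality the metric enters the analysis of
    the greedy algorithm. *)
Lemma metric4 I i i' j l : metric_mlufl I ->
  conn_cost I i' j <= conn_cost I i' l + conn_cost I i l + conn_cost I i j.
Proof.
case=> _ _ [d [_ _ dC dt de]]; rewrite -!de.
apply: le_trans (dt _ (inl i) _) _; rewrite lerD2r.
by apply: le_trans (dt _ (inr l) _) _; rewrite (dC (inr l)).
Qed.

Lemma size_next_route r i : size (next_route r i) = (size r + (i \notin r))%N.
Proof. by rewrite /next_route; case: ifP; rewrite ?addn0 // size_rcons addn1. Qed.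

Lemma mem_next_route r i : i \in next_route r i.
Proof. by rewrite /next_route; case: ifP => // _; rewrite mem_rcons mem_head. Qed.

Lemma next_route_sub r i i' : i' \in r -> i' \in next_route r i.
Proof. by rewrite /next_route; case: ifP => // _; rewrite mem_rcons inE orbC => ->. Qed.

Lemma index_next_route r i i' : i' \in r -> index i' (next_route r i) = index i' r.
Proof. by rewrite /next_route; case: ifP => // _ h; rewrite -cats1 index_cat h. Qed.

(** The left-hand side grows by at most [star_cost]: the connection costs of the star and, if i is
    new, its opening cost and one unit per unassigned client. The right-hand side grows by tau'
    times the size of the star, which is at least as much. *)
Lemma inv_paid_step I r phi a tau tau' i l :
  metric_mlufl I -> greedy_inv I r phi a tau -> best_star I r phi i l ->
  ratio I r phi i l <= tau' ->
  let r' := next_route r i in let phi' := next_assign I phi i l in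
  let a' j := if j \in unassigned phi then tau' else a j in
  \sum_(i <- r') open_cost I i +
    \sum_j (if phi' j is Some i then conn_cost I i j + (index i r').+1%:R
            else (size r')%:R)
    <= \sum_j (if phi' j is Some _ then a' j else 0).
Proof.
move=> hI hinv hb htau; cbv zeta.
set r' := next_route r i; set phi' := next_assign I phi i l; have [lU _] := hb.
pose a' j := if j \in unassigned phi then tau' else a j.
pose old j := if phi j is Some i then conn_cost I i j + (index i r).+1%:R
            else (size r)%:R : K.
pose extra j : K := (if j \in star I phi i l then conn_cost I i j else 0) +
   (if j \in unassigned phi then (i \notin r)%:R else 0).
have h1 : \sum_j (if phi' j is Some i then conn_cost I i j + (index i r').+1%:R
            else (size r')%:R) <= \sum_j (old j + extra j).
  apply: ler_sum => j _; rewrite /old /extra /phi' /next_assign.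
  have [jS|jS] := boolP (j \in star I phi i l).
    have jU := subsetP (star_sub I phi i l) j jS; rewrite jU.
    move: jU; rewrite inE => /eqP ->.
    rewrite addrCA lerD2l -natrD -size_next_route -/r' ler_nat.
    by rewrite index_mem mem_next_route.
  rewrite add0r inE; case E: (phi j) => [i'|] /=.
    by rewrite addr0 index_next_route //; apply: (inv_opened hinv) E.
  by rewrite -natrD -size_next_route.
have h2 : \sum_j (if phi' j is Some _ then a' j else 0) =
    \sum_j (if phi j is Some _ then a j else 0) + tau' * #|star I phi i l|%:R.
  rewrite mulr_natr -sumr_const [X in _ + X]big_mkcond -big_split; apply: eq_bigr => j _ /=.
  rewrite /phi' /next_assign /a'.
  have [jS|jS] := boolP (j \in star I phi i l).
    have jU := subsetP (star_sub I phi i l) j jS; rewrite jU.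
    by move: jU; rewrite inE => /eqP ->; rewrite add0r.
  by rewrite addr0 inE; case: (phi j).
have h3 : \sum_j extra j = \sum_(j in star I phi i l) conn_cost I i j
    + (i \notin r)%:R * #|unassigned phi|%:R.
  by rewrite big_split -!big_mkcond sumr_const mulr_natr.
have h4 : \sum_(i <- r') open_cost I i =
    \sum_(i <- r) open_cost I i + (i \notin r)%:R * open_cost I i.
  rewrite /r' /next_route; case: ifP => /= _; first by rewrite mul0r addr0.
  by rewrite -cats1 big_cat big_seq1 mul1r.
have h5 : star_cost I r phi i l <= tau' * #|star I phi i l|%:R.
  by rewrite -ratio_card // ler_wpM2r.
have h6 : delayed_cost I r phi i = (i \notin r)%:R * open_cost I i
    + (i \notin r)%:R * #|unassigned phi|%:R.
  by rewrite /delayed_cost; case: ifP => /= _; rewrite ?mul0r ?mul1r ?addr0.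
have h7 := inv_paid hinv; rewrite -/old in h7.
move: h1 h5; rewrite big_split /star_cost /= h3 h2 h4 h6 => h1 h5.
have : \sum_j old j = \sum_j (if phi j is Some i then conn_cost I i j + (index i r).+1%:R
            else (size r)%:R) by [].
by lra.
Qed.

Lemma greedy_inv_step I r phi a tau i l :
  metric_mlufl I -> greedy_inv I r phi a tau -> best_star I r phi i l ->
  exists a' tau', greedy_inv I (next_route r i) (next_assign I phi i l) a' tau'.
Proof.
move=> hI hinv hb; have [lU _] := hb; have [f0 c0 _] := hI.
set rho := ratio I r phi i l; pose tau' := Num.max tau rho.
have le_tau : tau <= tau' by rewrite le_max lexx.
have le_rho : rho <= tau' by rewrite le_max lexx orbT.
exists (fun j => if j \in unassigned phi then tau' else a j), tau'.
have aU j : j \in unassigned phi -> a j = tau by exact: (inv_unassigned hinv).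
have assd j i' : phi j = Some i' -> j \in unassigned phi = false.
  by rewrite inE => ->.
split.
- rewrite /next_route; case: ifP => // h; last rewrite rcons_uniq h /=;
  exact: (inv_uniq hinv).
- move=> i' j; rewrite /next_assign; case: ifP => [_ [<-]|_ h]; first exact: mem_next_route.
  by apply/next_route_sub/(inv_opened hinv)/h.
- by move=> j; case: ifP => _; [apply: le_trans le_tau; exact: (inv_tau_ge0 hinv)
    | exact: (inv_ge0 hinv)].
- exact: le_trans (inv_tau_ge0 hinv) le_tau.
- by move=> j; case: ifP => // _; apply: le_trans (inv_le hinv j) le_tau.
- by move=> j; rewrite next_assign_unassigned inE => /andP[_ ->].
- move=> i' j; rewrite /next_assign; case: ifP => [jS [<-]|_ h].
    rewrite (subsetP (star_sub I phi i l)) //.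
    by apply: le_trans (best_conn_le hI hb jS) le_rho.
  by rewrite (assd _ _ h); apply: inv_conn hinv _ _ h.
- move=> i' j B.
  have [jU|jU] := boolP (j \in unassigned phi); last first.
    (* For an assigned j, raising the unassigned levels from tau to tau' keeps them above a_j, so
       the set of clients at level a_j or more does not change. *)
    have e (x : 'I_m) : (a j <= if x \in unassigned phi then tau' else a x) = (a j <= a x).
      case: ifP => // xU; rewrite (aU x xU) (inv_le hinv).
      by apply: le_trans (inv_le hinv j) le_tau.
    move=> hB; rewrite (eq_card (B := [set x | a j <= a x])).
      by apply: (inv_star hinv) => x /hB; rewrite e.
    by move=> x; rewrite [LHS]in_set [RHS]in_set e.
  (* If rho <= tau, no level moves. Otherwise the clients at level rho or more are exactly the
     unassigned ones, and the minimality of the chosen star gives the bound. *)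
  have [hr|hr] := leP rho tau.
    have tt' : tau' = tau by apply/max_idPl.
    rewrite tt' => hB.
    have e (x : 'I_m) : (if x \in unassigned phi then tau else a x) = a x.
      by case: ifP => // xU; rewrite aU.
    rewrite (eq_card (B := [set x | a j <= a x])).
      rewrite -(aU _ jU); apply: (inv_star hinv) => x /hB.
      by rewrite e (aU _ jU).
    by move=> x; rewrite [LHS]in_set [RHS]in_set e (aU _ jU).
  have tt' : tau' = rho by apply/max_idPr/ltW.
  rewrite tt' => hB.
  have inU (x : 'I_m) : (rho <= if x \in unassigned phi then rho else a x) =
      (x \in unassigned phi).
    case: ifP => _; first by rewrite lexx.
    by apply/negbTE; rewrite -ltNge (le_lt_trans (inv_le hinv x)).
  have BU : B \subset unassigned phi by apply/subsetP => x /hB; rewrite inU.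
  rewrite (eq_card (B := unassigned phi)); last by move=> x; rewrite [LHS]in_set inU.
  exact: le_trans (best_ratio_sum_le i' hI hb BU) (delayed_cost_le _ _ _ hI).
- move=> i' j k.
  have nn : 0 <= conn_cost I i' k + conn_cost I i' j by rewrite addr_ge0.
  case: ifP => jU; last first.
    case: ifP => kU; last exact: (inv_metric hinv).
    by have := inv_le hinv j; lra.
  case: ifP => kU; first by lra.
  have [hr|hr] := leP rho tau.
    have -> : tau' = tau by apply/max_idPl.
    by rewrite -(aU _ jU); apply: (inv_metric hinv).
  have -> : tau' = rho by apply/max_idPr/ltW.
  (* The facility q that serves k is open, so rho <= c_qj <= c_i'j + c_i'k + c_qk, and c_qk <=
     a_k. *)
  move/negbT: kU; rewrite inE; case E: (phi k) => [q|] // _.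
  have := best_ratio_opened hb (inv_opened hinv E) jU.
  have := inv_conn hinv E; have := metric4 i' q j k hI; rewrite -/rho; lra.
- exact: (inv_paid_step hI hinv hb le_rho).
Qed.

Lemma greedy_inv_final I r phi a tau (h : 'I_m -> 'I_n) :
  metric_mlufl I -> greedy_inv I r phi a tau -> (forall j, phi j = Some (h j)) ->
  exists S : solution n m, [/\ route S = r, assign S = h &
    forall z, lp_feasible z -> cost I S <= 27 / 5 * lp_value I z].
Proof.
move=> hI hinv hphi.
have hr j : h j \in r by apply: (inv_opened hinv) (hphi j).
exists (Solution (inv_uniq hinv) hr); split=> // z hz.
have ha : dual_certificate I a.
  by split; [exact: inv_ge0 hinv|exact: inv_star hinv|exact: inv_metric hinv].
apply: le_trans (dual_certificate_bound hI ha hz).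
have := inv_paid hinv; rewrite /cost /position /=.
rewrite (eq_bigr (fun j => conn_cost I (h j) j + (index (h j) r).+1%:R)); last first.
  by move=> j _; rewrite hphi.
by move/le_trans; apply; apply: ler_sum => j _; rewrite hphi.
Qed.

Lemma ex_best_star I r phi : (0 < n)%N -> unassigned phi != set0 ->
  exists i l, best_star I r phi i l.
Proof.
move=> n0 /set0Pn[l0 l0U].
pose rat (p : 'I_n * 'I_m) := ratio I r phi p.1 p.2.
pose p := [arg min_(p < (Ordinal n0, l0) | p.2 \in unassigned phi) rat p]%O.
have [pU pmin] : p.2 \in unassigned phi /\
    forall q : 'I_n * 'I_m, q.2 \in unassigned phi -> rat p <= rat q.
  by rewrite /p; case: arg_minP.
exists p.1, p.2; split=> // i' l' l'U.
rewrite -(ratio_card _ _ _ pU) -(ratio_card _ _ _ l'U) mulrAC ler_wpM2r //.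
by rewrite ler_wpM2r // (pmin (i', l')).
Qed.

(** For real costs no program is available, so the greedy run is an existence proof by induction on
    a bound for the number of unassigned clients. *)
Lemma greedy_solution I : (0 < n)%N -> metric_mlufl I ->
  exists S : solution n m,
    forall z, lp_feasible z -> cost I S <= 27 / 5 * lp_value I z.
Proof.
move=> n0 hI.
suff H k r phi a tau : greedy_inv I r phi a tau -> (#|unassigned phi| < k)%N ->
    exists S : solution n m,
      forall z, lp_feasible z -> cost I S <= 27 / 5 * lp_value I z.
  exact: H (greedy_inv_init hI) (ltnSn _).
elim: k => // k IH in r phi a tau * => hinv hk.
have [U0|] := eqVneq (unassigned phi) set0; last first.
  move=> /(ex_best_star I r n0)[i [l hb]].
  have [a' [tau' hinv']] := greedy_inv_step hI hinv hb.
  have [lU _] := hb; apply: IH hinv' _.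
  exact: leq_trans (unassigned_next_lt I i lU) hk.
have hphi j : exists i, phi j == Some i.
  have /negbT : j \in unassigned phi = false by rewrite U0 inE.
  by rewrite inE; case: (phi j) => // i _; exists i.
have [S [_ _ hS]] := greedy_inv_final hI hinv (fun j => eqP (xchooseP (hphi j))).
by exists S.
Qed.

End Greedy.

(** * Running time of random access machine programs *)

(** The time analysis rests on one invariant: every cell holds at most b bits. Intermediate values
    are not stored and may be longer; [expr_size] and [expr_cost] measure their length and the
    evaluation time in units of b. *)
Definition small (b : nat) (s : memory) := forall a, (`|s a| < 2 ^ b)%N.

Fixpoint expr_size (e : expr) : nat :=
  match e with
  | Const _ | Read _ => 1
  | Add e1 e2 | Defs.Sub e1 e2 | Mul e1 e2 | Div e1 e2 => expr_size e1 + expr_size e2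
  end%N.

Fixpoint expr_cost (e : expr) : nat :=
  match e with
  | Const _ => 1
  | Read e1 => expr_cost e1 + expr_size e1 + 1
  | Add e1 e2 | Defs.Sub e1 e2 | Mul e1 e2 | Div e1 e2 =>
      expr_cost e1 + expr_cost e2 + expr_size e1 + expr_size e2
  end%N.

Fixpoint small_consts (e : expr) : bool :=
  match e with
  | Const k => (`|k| < 2 ^ 8)%N
  | Read e1 => small_consts e1
  | Add e1 e2 | Defs.Sub e1 e2 | Mul e1 e2 | Div e1 e2 => small_consts e1 && small_consts e2
  end.

(** 1000 is a generous bound, checked by computation for each expression of the solver; the
    difference of two connection costs in [for_star] stays well below it. *)
Definition cheap (e : expr) : bool :=
  small_consts e && (expr_cost e + expr_size e <= 1000)%N.

Lemma bits_le (z : int) (k : nat) : (0 < k)%N -> (`|z| < 2 ^ k)%N -> (bits z <= k)%N.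
Proof.
move=> k0 zk; rewrite /bits; case: (posnP `|z|%N) => [->|z0]; first by rewrite trunc_log0.
by rewrite -(ltn_exp2l _ _ (isT : (1 < 2)%N)) (leq_ltn_trans _ zk) ?trunc_logP.
Qed.

Lemma exp2_gt0 k : (0 < 2 ^ k)%N. Proof. by rewrite expn_gt0. Qed.

Lemma ltn_add_exp2 (x y p q : nat) : (0 < p)%N -> (0 < q)%N ->
  (x < 2 ^ p)%N -> (y < 2 ^ q)%N -> (x + y < 2 ^ (p + q))%N.
Proof.
move=> p0 q0 hx hy; rewrite expnD.
have : (2 <= 2 ^ p)%N by case: p p0 {hx} => // p _; rewrite expnS; have := exp2_gt0 p; lia.
have : (2 <= 2 ^ q)%N by case: q q0 {hy} => // q _; rewrite expnS; have := exp2_gt0 q; lia.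
nia.
Qed.

Lemma expr_size_gt0 e : (0 < expr_size e)%N.
Proof. by elim: e => //= e1 h1 e2 h2; rewrite addn_gt0 h1. Qed.

Lemma leq_absz_div (x y : int) : (`|(x %/ y)%Z| <= `|x|)%N.
Proof.
have hs : (`|sgz y| <= 1)%N by case: sgzP.
by case: x => x; rewrite /divz /= abszM; have := leq_div x `|y|; nia.
Qed.

Lemma eval_small b s e : (8 <= b)%N -> small b s -> small_consts e ->
  (`|eval s e| < 2 ^ (expr_size e * b))%N.
Proof.
move=> b8 hs; have b0 : (0 < b)%N by lia.
have pos e' : (0 < expr_size e' * b)%N by rewrite muln_gt0 expr_size_gt0.
elim: e => [k|e _|e1 IH1 e2 IH2|e1 IH1 e2 IH2|e1 IH1 e2 IH2|e1 IH1 e2 IH2].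
- by rewrite [small_consts _]/= mul1n => /leq_trans; apply; rewrite leq_exp2l.
- by rewrite mul1n => _; apply: hs.
- move=> /andP[/IH1 h1 /IH2 h2]; rewrite mulnDl /=.
  apply: leq_ltn_trans (ltn_add_exp2 (pos e1) (pos e2) h1 h2); lia.
- move=> /andP[/IH1 h1 /IH2 h2]; rewrite mulnDl /=.
  apply: leq_ltn_trans (ltn_add_exp2 (pos e1) (pos e2) h1 h2); lia.
- move=> /andP[/IH1 h1 /IH2 h2]; rewrite mulnDl /= abszM expnD.
  by apply: ltn_mul.
- move=> /andP[/IH1 h1 _]; rewrite mulnDl /=.
  have le : (2 ^ (expr_size e1 * b) <= 2 ^ (expr_size e1 * b + expr_size e2 * b))%N.
    by rewrite leq_exp2l // leq_addr.
  apply: leq_trans le; apply: leq_ltn_trans h1.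
  exact: leq_absz_div.
Qed.

Lemma eval_bits b s e : (8 <= b)%N -> small b s -> small_consts e ->
  (bits (eval s e) <= expr_size e * b)%N.
Proof.
move=> b8 hs he; apply: bits_le; last exact: eval_small.
by rewrite muln_gt0 expr_size_gt0 /=; lia.
Qed.

Lemma eval_time_le b s e : (8 <= b)%N -> small b s -> small_consts e ->
  (eval_time s e <= expr_cost e * b)%N.
Proof.
move=> b8 hs; have b0 : (0 < b)%N by lia.
have bin e1 e2 : (small_consts e1 -> eval_time s e1 <= expr_cost e1 * b)%N ->
    (small_consts e2 -> eval_time s e2 <= expr_cost e2 * b)%N ->
    small_consts e1 && small_consts e2 ->
    (eval_time s e1 + eval_time s e2 + bits (eval s e1) + bits (eval s e2) <=
     (expr_cost e1 + expr_cost e2 + expr_size e1 + expr_size e2) * b)%N.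
  move=> IH1 IH2 /andP[c1 c2]; rewrite !mulnDl.
  by rewrite !leq_add ?IH1 ?IH2 ?eval_bits.
elim: e => [k|e IH|e1 IH1 e2 IH2|e1 IH1 e2 IH2|e1 IH1 e2 IH2|e1 IH1 e2 IH2];
  try exact: bin.
- by move=> h; apply: (eval_bits (e := Const k) b8 hs h).
- move=> h; rewrite /= !mulnDl !leq_add ?IH ?eval_bits //.
  by rewrite mul1n; apply: bits_le.
Qed.

Lemma cheap_time b s e : (8 <= b)%N -> small b s -> cheap e ->
  (eval_time s e + bits (eval s e) <= 1000 * b)%N.
Proof.
move=> b8 hs /andP[he hc]; apply: (@leq_trans ((expr_cost e + expr_size e) * b)%N).
  by rewrite mulnDl leq_add ?eval_time_le ?eval_bits.
by rewrite leq_mul2r hc orbT.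
Qed.

(* N counts elementary operations, each of which is charged 2000 b. *)
Definition wp b (P : program) (N : nat) (Q : memory -> Prop) (s : memory) :=
  exists T s', [/\ exec P s T s', (T <= N * (2000 * b))%N & Q s'].

(** Two cheap expressions are evaluated, the address and the value, at 1000 b each; hence the unit
    2000 b. *)
Lemma wp_store b a e N Q s : (8 <= b)%N -> small b s -> (0 < N)%N ->
  cheap a -> cheap e -> Q (update s (eval s a) (eval s e)) ->
  wp b (Store a e) N Q s.
Proof.
move=> b8 hs N0 ca ce hQ; do 2!eexists; split; [exact: exec_store| |exact: hQ].
have := cheap_time b8 hs ca; have := cheap_time b8 hs ce; nia.
Qed.

Lemma wp_skip b N Q s : (8 <= b)%N -> (0 < N)%N -> Q s -> wp b Skip N Q s.
Proof. move=> b8 N0 h; exists 1%N, s; split => //; [exact: exec_skip|nia]. Qed.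

Lemma wp_seq b P P' N N' Q s :
  wp b P N (fun s' => wp b P' N' Q s') s -> wp b (Seq P P') (N + N') Q s.
Proof.
move=> [T [s' [h1 l1 [T' [s'' [h2 l2 hQ]]]]]].
by exists (T + T')%N, s''; split => //; [exact: exec_seq h1 h2|rewrite mulnDl leq_add].
Qed.

Lemma wp_if b e P P' N Q s : (8 <= b)%N -> small b s -> cheap e ->
  (0 < eval s e -> wp b P N Q s) -> (eval s e <= 0 -> wp b P' N Q s) ->
  wp b (If e P P') N.+1 Q s.
Proof.
move=> b8 hs ce h1 h2; have ct := cheap_time b8 hs ce.
case: (ltP 0 (eval s e)) => he.
  have [T [s' [h l hQ]]] := h1 he.
  by do 2!eexists; split; [exact: exec_if_true he h|nia|].
have [T [s' [h l hQ]]] := h2 he.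
by do 2!eexists; split; [exact: exec_if_false he h|nia|].
Qed.

Lemma wp_weaken b P N N' (Q Q' : memory -> Prop) s : (N <= N')%N ->
  (forall s', Q s' -> Q' s') -> wp b P N Q s -> wp b P N' Q' s.
Proof.
move=> le hQ [T [s' [h l q]]]; exists T, s'; split; [by []| |exact: hQ].
by rewrite (leq_trans l) // leq_mul2r le orbT.
Qed.

(** k is a variant that may drop by more than one, as in the main loop, where one round can assign
    several clients. The final [.+1] pays for the failing test. *)
Lemma wp_while b e P N (inv : nat -> memory -> Prop) (Q : memory -> Prop) k s :
  (8 <= b)%N -> cheap e -> (forall k s, inv k s -> small b s) ->
  (forall k s, inv k s -> 0 < eval s e ->
     wp b P N (fun s' => exists2 k', (k' < k)%N & inv k' s') s) ->
  (forall k s, inv k s -> eval s e <= 0 -> Q s) ->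
  inv k s -> wp b (While e P) (k * N.+1).+1 Q s.
Proof.
move=> b8 ce hsmall hstep hend; elim/ltn_ind: k s => k IH s hinv.
have ct := cheap_time b8 (hsmall _ _ hinv) ce.
case: (ltP 0 (eval s e)) => he; last first.
  exists (eval_time s e + bits (eval s e))%N, s.
  by split; [exact: exec_while_false|nia|exact: hend hinv he].
have [T [s' [h l [k' kk' hinv']]]] := hstep _ _ hinv he.
have [T' [s'' [h' l' q]]] := IH _ kk' _ hinv'.
by do 2!eexists; split; [exact: exec_while_true he h h'|nia|exact: q].
Qed.

Lemma wp_for b e P N (K : nat) (inv : nat -> memory -> Prop) s :
  (8 <= b)%N -> cheap e -> (forall k s, inv k s -> small b s) ->
  (forall k s, inv k s -> eval s e = K%:Z - k%:Z) ->
  (forall k s, (k < K)%N -> inv k s -> wp b P N (inv k.+1) s) ->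
  inv 0%N s -> wp b (While e P) (K * N.+1).+1 (inv K) s.
Proof.
move=> b8 ce hsmall hval hstep h0.
apply: (wp_while (inv := fun k s => exists2 i, (i <= K)%N /\ k = (K - i)%N & inv i s)) => //.
- by move=> k s' [i _ /hsmall].
- move=> k s' [i [iK ->] hi]; rewrite (hval _ _ hi) => pos.
  have iK' : (i < K)%N by lia.
  apply: wp_weaken (leqnn _) _ (hstep _ _ iK' hi) => s'' hi'.
  by exists (K - i.+1)%N; [lia|exists i.+1].
- move=> k s' [i [iK _] hi]; rewrite (hval _ _ hi) => neg.
  by have -> : K = i by lia.
- by exists 0%N; rewrite ?subn0.
Qed.

Lemma small_update b s a v : small b s -> (`|v| < 2 ^ b)%N -> small b (update s a v).
Proof. by move=> hs hv a'; rewrite /update; case: eqP. Qed.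

(** * The greedy algorithm as a program *)

(* The negative addresses hold four interleaved arrays: the registers (q = 0),
   the flags of the opened facilities (q = 1), the facilities assigned to the
   clients, shifted by one, with 0 for unassigned clients (q = 2), and the route (q = 3).
   Registers: 0, 1, 2 hold n, m and the common denominator; 3 and 4 the numbers
   of unassigned clients and of opened facilities; 5, 6, 7 are indices; 8 and 9
   hold the cost and the size of the current star; 10 to 13 the best star found
   and its cost and size; 14 is a loop counter. *)
Definition addr (q i : nat) : int := Negz (4 * i + q).
Arguments addr : simpl never.

Local Notation "P ;; Q" := (Seq P Q) (at level 90, right associativity).

(** Computes [addr q i], since [Negz (4 * i + q)] is -(q + 1) - 4 i. *)
Definition cell (q : nat) (e : expr) : expr :=
  Defs.Sub (Const (- q.+1%:Z)) (Mul (Const 4) e).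
Definition reg (k : nat) : expr := Read (Const (addr 0 k)).
Definition put (k : nat) (e : expr) : program := Store (Const (addr 0 k)) e.
Definition incr (k : nat) : program := put k (Add (reg k) (Const 1)).

(** Cost number p has its numerator in cell 2 + 2 p and its denominator in cell 3 + 2 p. Register 2
    is a multiple of that denominator, so the division is exact. *)
Definition scaled (e : expr) : expr :=
  Mul (Read (Add (Const 2) (Mul (Const 2) e)))
      (Div (reg 2) (Read (Add (Const 3) (Mul (Const 2) e)))).
Definition conn (ei ej : expr) : expr := scaled (Add (Add (reg 0) (Mul ei (reg 1))) ej).

Definition for_star (ki kl : nat) (P : program) : program :=
  While (Defs.Sub (reg 1) (reg 7))
    (If (Read (cell 2 (reg 7))) Skip
       (If (Defs.Sub (conn (reg ki) (reg 7)) (conn (reg ki) (reg kl))) Skip P) ;;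
     incr 7).

Definition sum_star : program :=
  for_star 5 6 (put 8 (Add (reg 8) (conn (reg 5) (reg 7))) ;; incr 9).

(** Pairs (i, l) are numbered i m + l in register 14: one loop replaces two nested ones, and
    division recovers i and l. *)
Definition search_body : program :=
  put 5 (Div (reg 14) (reg 1)) ;;
  put 6 (Defs.Sub (reg 14) (Mul (reg 5) (reg 1))) ;;
  If (Read (cell 2 (reg 6))) Skip
    (If (Read (cell 1 (reg 5))) (put 8 (Const 0))
        (put 8 (Add (scaled (reg 5)) (Mul (reg 2) (reg 3)))) ;;
     put 9 (Const 0) ;;
     put 7 (Const 0) ;;
     sum_star ;;
     If (Defs.Sub (Mul (reg 12) (reg 9)) (Mul (reg 8) (reg 13)))
       (put 10 (reg 5) ;; put 11 (reg 6) ;; put 12 (reg 8) ;; put 13 (reg 9))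
       Skip).

(** The best fraction starts as 1/0, that is infinity, so the first candidate always wins the
    cross-multiplied test. *)
Definition search : program :=
  put 12 (Const 1) ;; put 13 (Const 0) ;; put 14 (Const 0) ;;
  While (Defs.Sub (Mul (reg 0) (reg 1)) (reg 14)) (search_body ;; incr 14).

Definition open_facility : program :=
  If (Read (cell 1 (reg 10))) Skip
    (Store (cell 1 (reg 10)) (Const 1) ;; Store (cell 3 (reg 4)) (reg 10) ;; incr 4).

Definition assign_star : program :=
  put 7 (Const 0) ;;
  for_star 10 11 (Store (cell 2 (reg 7)) (Add (reg 10) (Const 1)) ;;
                  put 3 (Defs.Sub (reg 3) (Const 1))).

Definition greedy : program :=
  While (reg 3) (search ;; open_facility ;; assign_star).

(** The loop counter 14, the number 4 of open facilities and the arrays need no initialisation: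
    negative cells are 0 after [load]. *)
Definition prologue : program :=
  put 0 (Read (Const 0)) ;; put 1 (Read (Const 1)) ;; put 2 (Const 1) ;;
  While (Defs.Sub (Add (reg 0) (Mul (reg 0) (reg 1))) (reg 14))
    (put 2 (Mul (reg 2) (Read (Add (Const 3) (Mul (Const 2) (reg 14))))) ;; incr 14) ;;
  put 3 (reg 1).

(** The output overwrites the input from address 0 on, which is safe because all working data live
    at negative addresses. *)
Definition epilogue : program :=
  Store (Const 0) (reg 4) ;; put 7 (Const 0) ;;
  While (Defs.Sub (reg 4) (reg 7))
    (Store (Add (Const 1) (reg 7)) (Read (cell 3 (reg 7))) ;; incr 7) ;;
  put 7 (Const 0) ;;
  While (Defs.Sub (reg 1) (reg 7))
    (Store (Add (Add (Const 1) (reg 4)) (reg 7))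
       (Defs.Sub (Read (cell 2 (reg 7))) (Const 1)) ;; incr 7).

Definition solver : program := prologue ;; greedy ;; epilogue.

Lemma updE s q i v q' i' : (q < 4)%N -> (q' < 4)%N ->
  update s (addr q i) v (addr q' i') =
  if (q' == q) && (i' == i) then v else s (addr q' i').
Proof.
move=> hq hq'; rewrite /update /addr; case: eqP => [[e]|ne]; case: andP => //.
  by case; split; apply/eqP; lia.
by case=> /eqP eq /eqP ei; case: ne; rewrite eq ei.
Qed.

Lemma upd_pos s q i v (k : nat) : update s (addr q i) v k%:Z = s k%:Z.
Proof. by []. Qed.

Lemma eval_cell s q e (k : nat) : eval s e = k%:Z -> eval s (cell q e) = addr q k.
Proof. by move=> /= ->; rewrite /addr NegzE; lia. Qed.

Definition frame (X : seq nat) (s s' : memory) :=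
  (forall k : nat, s' k%:Z = s k%:Z) /\
  forall q k, (q < 4)%N -> (q == 0%N) && (k \in X) = false ->
    s' (addr q k) = s (addr q k).

Lemma frame_refl X s : frame X s s. Proof. by []. Qed.

Lemma frame_trans X s1 s2 s3 : frame X s1 s2 -> frame X s2 s3 -> frame X s1 s3.
Proof.
by move=> [p1 n1] [p2 n2]; split=> [k|q k q4 hk]; rewrite ?p2 ?n2 ?p1 ?n1.
Qed.

Lemma frame_sub X Y s s' : all (fun k => k \in Y) X -> frame X s s' -> frame Y s s'.
Proof.
move=> /allP XY [p h]; split=> // q k q4 hk; apply: h => //; apply: contraFF hk.
by case/andP=> -> /XY ->.
Qed.

Lemma frame_update X s s' k v :
  k \in X -> frame X s s' -> frame X s (update s' (addr 0 k) v).
Proof.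
move=> kX [p h]; split=> [i|q i q4 hk]; first by rewrite upd_pos.
rewrite updE //; case: ifP => [/andP[/eqP e1 /eqP e2]|_]; last exact: h.
by rewrite e1 e2 kX in hk.
Qed.

Definition den (w : seq int) (p : nat) : int := nth 0 w (3 + 2 * p).
Definition den_prod (w : seq int) (k : nat) : int := \prod_(0 <= p < k) den w p.

(** Keeps the running product of the prologue below its final value, hence within b bits. *)
Lemma den_prod_mono (w : seq int) (k N : nat) : (forall p, (p < N)%N -> 0 < den w p) -> (k <= N)%N ->
  0 < den_prod w k <= den_prod w N.
Proof.
move=> h kN; have pos j : (j <= N)%N -> 0 < den_prod w j.
  move=> jN; rewrite /den_prod big_seq prodr_gt0 // => p.
  by rewrite mem_index_iota => /andP[_ pj]; apply: h; apply: leq_trans pj jN.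
rewrite pos //=; elim: N => [|N IH] in kN h pos *; first by move: kN; rewrite leqn0 => /eqP ->.
move: kN; rewrite leq_eqVlt => /orP[/eqP -> //|kN].
apply: le_trans (IH kN _ _) _ => [p pN|j jN|]; [by apply: h; lia|by apply: pos; lia|].
rewrite {2}/den_prod big_nat_recr //= -/(den_prod w N).
by have := h N (ltnSn _); have := pos N (leqnSn _); nia.
Qed.

(** * Correctness and step counts of the program *)

Section Verification.
Context {R : realFieldType} {n m : nat} (I : mlufl R n m).
Context (w : seq int) (D : int) (b : nat).
Implicit Types (s : memory) (r : seq 'I_n) (phi : 'I_m -> option 'I_n).

Definition scaled_cost (p : nat) : int :=
  nth 0 w (2 + 2 * p) * (D %/ nth 0 w (3 + 2 * p))%Z.
Definition open_int (i : nat) : int := scaled_cost i.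
Definition conn_int (i j : nat) : int := scaled_cost (n + i * m + j).

Hypothesis metricI : metric_mlufl I.
Hypothesis D_gt0 : 0 < D.
Hypothesis open_scaled : forall i : 'I_n, (open_int i)%:~R = D%:~R * open_cost I i.
Hypothesis conn_scaled : forall (i : 'I_n) (j : 'I_m), (conn_int i j)%:~R = D%:~R * conn_cost I i j.
Hypothesis b_ge8 : (8 <= b)%N.
Hypothesis index_bound : (n + m + n * m + 2 < 2 ^ b)%N.
(** Bounds every partial sum that [sum_star] stores; the larger products in the tests are never
    stored. *)
Hypothesis star_bound :
  forall i : 'I_n, open_int i + D * m%:Z + \sum_(j < m) conn_int i j < (2 ^ b)%N%:Z.

Record env s : Prop := Env {
  env_n : s (addr 0 0) = n;
  env_m : s (addr 0 1) = m;
  env_D : s (addr 0 2) = D;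
  env_input : forall k : nat, s k%:Z = nth 0 w k;
  env_small : small b s }.

Record rep s r phi : Prop := Rep {
  rep_opened : forall i : 'I_n, s (addr 1 i) = (i \in r : nat)%:Z;
  rep_assigned : forall j : 'I_m,
    s (addr 2 j) = (if phi j is Some i then (val i).+1 else 0%N)%:Z;
  rep_route : forall k, (k < size r)%N -> s (addr 3 k) = (nth 0%N (map val r) k)%:Z;
  rep_unassigned : s (addr 0 3) = #|unassigned phi|%:Z;
  rep_size : s (addr 0 4) = (size r)%:Z }.

Lemma env_frame X s s' : all (leq 3) X -> frame X s s' -> small b s' -> env s -> env s'.
Proof.
move=> /allP hX [p h] hs [e0 e1 e2 e3 _]; split=> // [|||k]; last by rewrite p.
all: rewrite h //; apply/negbTE/negP => /= /hX; lia.
Qed.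

Lemma rep_frame X s s' r phi : all (leq 5) X -> frame X s s' -> rep s r phi -> rep s' r phi.
Proof.
move=> /allP hX [p h] [e0 e1 e2 e3 e4]; split=> // [i|j|k kr||].
- by rewrite h.
- by rewrite h.
- by rewrite h // e2.
- by rewrite h //; apply/negbTE/negP => /= /hX.
- by rewrite h //; apply/negbTE/negP => /= /hX.
Qed.

Lemma conn_int_ge0 (i : 'I_n) (j : 'I_m) : 0 <= conn_int i j.
Proof.
by rewrite -(ler0z R) conn_scaled; apply: mulr_ge0; [rewrite ler0z ltW|case: metricI].
Qed.

Lemma open_int_ge0 (i : 'I_n) : 0 <= open_int i.
Proof.
by rewrite -(ler0z R) open_scaled; apply: mulr_ge0; [rewrite ler0z ltW|case: metricI].
Qed.

Lemma conn_int_le (i : 'I_n) (j l : 'I_m) :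
  (conn_int i j <= conn_int i l) = (conn_cost I i j <= conn_cost I i l).
Proof. by rewrite -(ler_int R) !conn_scaled ler_pM2l // ltr0z. Qed.

Lemma eval_scaled s e (p : nat) :
  env s -> eval s e = p%:Z -> eval s (scaled e) = scaled_cost p.
Proof.
move=> [_ _ hD hin _] /= ->; rewrite hD /scaled_cost.
by rewrite -!(PoszM, PoszD) !hin.
Qed.

Lemma eval_conn s ei ej (i j : nat) : env s -> eval s ei = i%:Z -> eval s ej = j%:Z ->
  eval s (conn ei ej) = conn_int i j.
Proof.
move=> he hi hj; apply: eval_scaled => //=; case: he => -> -> _ _ _.
by rewrite hi hj -!(PoszM, PoszD).
Qed.

Definition partial_sum (k : nat) (S : {set 'I_m}) (f : 'I_m -> int) : int :=
  \sum_(j | (val j < k)%N && (j \in S)) f j.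

Lemma partial_sum0 S f : partial_sum 0 S f = 0.
Proof. by rewrite /partial_sum big_pred0. Qed.

Lemma partial_sumS (j : 'I_m) S f :
  partial_sum j.+1 S f = partial_sum j S f + (if j \in S then f j else 0).
Proof.
rewrite /partial_sum; case: ifP => jS.
  rewrite (bigD1 j) /= ?ltnSn ?jS // addrC; congr (_ + _); apply: eq_bigl => i.
  by rewrite ltnS [(i <= j)%N]leq_eqVlt -val_eqE; case: ltngtP => //=; rewrite ?andbT ?andbF.
rewrite addr0; apply: eq_bigl => i.
rewrite ltnS leq_eqVlt; case: eqVneq => //= /val_inj ->.
by rewrite jS ltnn.
Qed.

Lemma partial_sumT S f : partial_sum m S f = \sum_(j in S) f j.
Proof. by apply: eq_bigl => j; rewrite ltn_ord. Qed.

Lemma partial_sum_le k S f : (forall j, 0 <= f j) -> 0 <= partial_sum k S f <= \sum_j f j.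
Proof.
move=> f0; rewrite sumr_ge0 //= /partial_sum big_mkcond; apply: ler_sum => j _.
by case: ifP.
Qed.

Lemma absz_lt (z : int) (N : nat) : 0 <= z -> z < N%:Z -> (`|z| < N)%N.
Proof. lia. Qed.

Definition assign_code phi (j : 'I_m) : int :=
  (if phi j is Some i then (val i).+1 else 0%N)%:Z.

(** [inv k] holds before client k is treated. Array 2 has to agree with phi from k on only, because
    [assign_star] overwrites the entries already passed; the star stays that of the fixed phi. *)
Lemma for_star_ok ki kl P N (i : 'I_n) (l : 'I_m) phi (inv : nat -> memory -> Prop) s :
  cheap (Defs.Sub (conn (reg ki) (reg 7)) (conn (reg ki) (reg kl))) ->
  (forall k s, inv k s -> [/\ env s, s (addr 0 7) = k, s (addr 0 ki) = i%:Z,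
     s (addr 0 kl) = l%:Z &
     forall j : 'I_m, (k <= j)%N -> s (addr 2 j) = assign_code phi j]) ->
  (forall (j : 'I_m) s, inv j s -> j \in star I phi i l ->
     wp b P N (fun s' => [/\ s' (addr 0 7) = j, small b s' &
       inv j.+1 (update s' (addr 0 7) j.+1)]) s) ->
  (forall (j : 'I_m) s, inv j s -> j \notin star I phi i l ->
     inv j.+1 (update s (addr 0 7) j.+1)) ->
  inv 0%N s -> wp b (for_star ki kl P) (m * (N + 5)).+1 (inv m) s.
Proof.
move=> hc hinv hin hout h0; rewrite addnS.
apply: wp_for h0 => //.
- by move=> k s' /hinv[[]].
- by move=> k s' /hinv[[_ h1 _ _ _] h2 _ _ _]; rewrite /= h1 h2.
move=> k s' km h; have [he h7 hi hl hj] := hinv _ _ h.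
have hs := env_small he.
pose j : 'I_m := Ordinal km.
have hj2 : eval s' (Read (cell 2 (reg 7))) = assign_code phi j.
  by rewrite -(hj j (leqnn _)) -(eval_cell 2 (e := reg 7) (s := s')).
have k_lt : (k.+1 < 2 ^ b)%N by lia.
have incr7 s1 : s1 (addr 0 7) = k -> small b s1 -> inv k.+1 (update s1 (addr 0 7) k.+1) ->
    wp b (incr 7) 1 (inv k.+1) s1.
  by move=> e1 hs1 h1; apply: wp_store => //=; rewrite e1 -PoszD addn1.
have hskip : j \notin star I phi i l ->
    wp b Skip (N + 1) (fun s1 => wp b (incr 7) 1 (inv k.+1) s1) s'.
  by move=> jS; apply: wp_skip; [by []|by lia|apply: incr7 => //; apply: (hout j)].
have -> : (N + 4 = (N + 1).+2 + 1)%N by lia.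
apply: wp_seq; apply: wp_if => //.
  rewrite hj2 => ha; apply: (wp_weaken (leqnSn _) (fun s' h => h)); apply: hskip.
  by rewrite !inE; move: ha; rewrite /assign_code; case: (phi j).
rewrite hj2 => ha.
have jU : j \in unassigned phi.
  by rewrite inE; move: ha; rewrite /assign_code; case: (phi j).
have hsub : eval s' (Defs.Sub (conn (reg ki) (reg 7)) (conn (reg ki) (reg kl)))
    = conn_int i j - conn_int i l.
  by rewrite -(@eval_conn s' (reg ki) (reg 7) i j he hi h7)
    -(@eval_conn s' (reg ki) (reg kl) i l he hi hl).
apply: wp_if => //; rewrite hsub.
  rewrite subr_gt0 => hlt; apply: hskip.
  by rewrite inE jU /= -conn_int_le -ltNge.
rewrite subr_le0 conn_int_le => hle.
have jS : j \in star I phi i l by rewrite inE jU.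
apply: wp_weaken (hin j _ h jS); first by lia.
by move=> s1 [e1 hs1 h1]; apply: incr7.
Qed.

Lemma sum_star_ok s r phi (i : 'I_n) (l : 'I_m) (g : int) :
  env s -> rep s r phi -> s (addr 0 5) = i -> s (addr 0 6) = l ->
  s (addr 0 7) = 0 -> s (addr 0 8) = g -> s (addr 0 9) = 0 ->
  0 <= g <= open_int i + D * m%:Z ->
  wp b sum_star (m * 7).+1 (fun s' => [/\ frame [:: 7; 8; 9] s s', small b s',
    s' (addr 0 8) = g + \sum_(j in star I phi i l) conn_int i j &
    s' (addr 0 9) = #|star I phi i l|]) s.
Proof.
move=> he hr h5 h6 h7 h8 h9 /andP[g0 gle].
pose inv k s' := [/\ frame [:: 7; 8; 9] s s', small b s', s' (addr 0 7) = k%:Z,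
  s' (addr 0 8) = g + partial_sum k (star I phi i l) (fun j => conn_int i j) &
  s' (addr 0 9) = partial_sum k (star I phi i l) (fun=> 1)].
apply: (wp_weaken (leqnn _) (Q := inv m)).
  move=> s' [hf hs _ e8 e9]; split=> //; first by rewrite e8 partial_sumT.
  by rewrite e9 partial_sumT sumr_const -mulr_natr mul1r natz.
apply: (for_star_ok (N := 2) (i := i) (l := l) (phi := phi)) => //.
- move=> k s' [hf hs e7 _ _]; split=> //.
  + exact: env_frame hf hs he.
  + by rewrite hf.2.
  + by rewrite hf.2.
  + by move=> j _; rewrite hf.2 // (rep_assigned hr).
- move=> j s1 [hf hs e7 e8 e9] jS.
  have he1 := env_frame (X := [:: 7; 8; 9]) isT hf hs he.
  have hC : eval s1 (conn (reg 5) (reg 7)) = conn_int i j.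
    by apply: eval_conn => //=; rewrite hf.2.
  have := partial_sum_le j (star I phi i l) (conn_int_ge0 i).
  have := partial_sum_le j.+1 (star I phi i l) (conn_int_ge0 i).
  have := partial_sum_le j.+1 (star I phi i l) (fun=> ler01 : 0 <= 1 :> int).
  rewrite sumr_const card_ord -mulr_natr mul1r natz.
  rewrite !partial_sumS jS => /= /andP[a1 b1] /andP[a2 b2] /andP[a3 b3].
  have sb := star_bound i.
  apply: (wp_seq (N := 1) (N' := 1)); apply: wp_store => //.
  have -> : eval s1 (Add (reg 8) (conn (reg 5) (reg 7))) =
      g + partial_sum j (star I phi i l) (fun j0 : 'I_m => conn_int i j0) + conn_int i j.
    by rewrite -hC -e8.
  rewrite [eval _ (Const _)]/=.
  have hs2 : small b (update s1 (addr 0 8)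
      (g + partial_sum j (star I phi i l) (fun j0 : 'I_m => conn_int i j0) + conn_int i j)).
    by apply: small_update => //; apply: absz_lt; lra.
  set s2 := update s1 _ _ in hs2 *.
  have e9' : s2 (addr 0 9) = partial_sum j (star I phi i l) (fun=> 1).
    by rewrite /s2 updE.
  apply: wp_store => //=; rewrite e9' /s2 {e9'}.
  split.
  + by rewrite !updE.
  + by apply: small_update => //; have := ltn_ord j; lia.
  split.
  + by do 3!apply: frame_update => //.
  + by apply: small_update => //; [apply: small_update => //|]; have := ltn_ord j; lia.
  + by rewrite updE.
  + by rewrite !updE //= partial_sumS jS addrA.
  + by rewrite !updE //= partial_sumS jS.
- move=> j s1 [hf hs e7 e8 e9] /negbTE jS; split.
  + exact: frame_update.
  + by apply: small_update => //; have := ltn_ord j; lia.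
  + by rewrite updE.
  + by rewrite updE //= partial_sumS jS addr0.
  + by rewrite updE //= partial_sumS jS addr0.
- by split; rewrite ?partial_sum0 ?addr0 //; apply: env_small he.
Qed.

Section Search.
Context (r : seq 'I_n) (phi : 'I_m -> option 'I_n).

Definition delayed_int (i : 'I_n) : int :=
  if i \in r then 0 else open_int i + D * #|unassigned phi|%:Z.
Definition cost_int i l : int :=
  delayed_int i + \sum_(j in star I phi i l) conn_int i j.
Definition card_int i l : int := #|star I phi i l|%:Z.

Lemma cost_int_scaled i l : (cost_int i l)%:~R = D%:~R * star_cost I r phi i l.
Proof.
rewrite /cost_int /star_cost rmorphD rmorph_sum mulrDr mulr_sumr /=; congr (_ + _).
  rewrite /delayed_int /delayed_cost; case: ifP => _; first by rewrite mulr0.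
  by rewrite rmorphD rmorphM /= open_scaled mulrDr.
by apply: eq_bigr => j _; rewrite conn_scaled.
Qed.

Lemma best_star_int i l : l \in unassigned phi ->
  (forall i' l', l' \in unassigned phi ->
     cost_int i l * card_int i' l' <= cost_int i' l' * card_int i l) ->
  best_star I r phi i l.
Proof.
move=> lU h; split=> // i' l' /(h i'); rewrite -(ler_int R) !rmorphM /= !cost_int_scaled.
by rewrite -!mulrA ler_pM2l // ltr0z.
Qed.

Lemma delayed_int_bound i : 0 <= delayed_int i <= open_int i + D * m%:Z.
Proof.
have F0 := open_int_ge0 i; have h : (#|unassigned phi| <= m)%N.
  by rewrite -[X in (_ <= X)%N](card_ord m) max_card.
rewrite /delayed_int; case: ifP => _; nia.
Qed.

Lemma cost_int_bound i l : 0 <= cost_int i l < (2 ^ b)%N%:Z.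
Proof.
have /andP[h1 h2] := delayed_int_bound i; have h3 := star_bound i.
have /andP[h4 h5] := partial_sum_le m (star I phi i l) (conn_int_ge0 i).
move: h4 h5; rewrite partial_sumT /cost_int => h4 h5; lra.
Qed.

Lemma card_int_le i l : card_int i l <= m%:Z.
Proof. by rewrite lez_nat -[X in (_ <= X)%N](card_ord m) max_card. Qed.

Lemma card_int_gt0 i l : l \in unassigned phi -> 0 < card_int i l.
Proof. by move/(card_star_gt0 I i); rewrite ltr0n ltz_nat. Qed.

(** In the first alternative no unassigned client has been met among the first p pairs, and
    registers 12 and 13 still hold the initial fraction 1/0. *)
Definition best_so_far (p : nat) s :=
  [/\ forall (i : 'I_n) (l : 'I_m), (i * m + l < p)%N -> l \notin unassigned phi,
      s (addr 0 12) = 1 & s (addr 0 13) = 0] \/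
  exists i l, [/\ l \in unassigned phi, s (addr 0 10) = Posz (val i), s (addr 0 11) = Posz (val l),
    s (addr 0 12) = cost_int i l /\ s (addr 0 13) = card_int i l &
    forall (i' : 'I_n) (l' : 'I_m), (i' * m + l' < p)%N -> l' \in unassigned phi ->
     cost_int i l * card_int i' l' <= cost_int i' l' * card_int i l].

Lemma best_so_far_frame p s s' :
  frame [:: 5; 6; 7; 8; 9; 14] s s' -> best_so_far p s -> best_so_far p s'.
Proof.
move=> hf; have e k : (9 < k < 14)%N -> s' (addr 0 k) = s (addr 0 k).
  by move=> hk; rewrite hf.2 //; apply/negbTE; rewrite !inE; lia.
case=> [[h1 h2 h3]|[i [l [h1 h2 h3 [h4 h5] h6]]]]; [left|right; exists i, l].
  by split; rewrite ?e.
by split; rewrite ?e.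
Qed.

Lemma pair_index (i i' : 'I_n) (l l' : 'I_m) (p : nat) : p = (i * m + l)%N ->
  (i' * m + l' < p.+1)%N -> (i' * m + l' < p)%N \/ i' = i /\ l' = l.
Proof.
move=> ->; rewrite ltnS leq_eqVlt => /orP[/eqP e|]; [right|by left].
have m0 : (0 < m)%N by apply: leq_ltn_trans (ltn_ord l).
split; apply: val_inj => /=.
  by have := congr1 (divn^~ m) e; rewrite !divnMDl // !divn_small // !addn0.
by have := congr1 (modn^~ m) e; rewrite !modnMDl !modn_small.
Qed.

Lemma best_so_far_skip (i : 'I_n) (l : 'I_m) (p : nat) s :
  p = (i * m + l)%N -> l \notin unassigned phi ->
  best_so_far p s -> best_so_far p.+1 s.
Proof.
move=> ep lU [[h1 h2 h3]|[i0 [l0 [h1 h2 h3 h4 h6]]]].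
  by left; split=> // i' l' /(pair_index ep)[|[_ ->]] //; apply: h1.
right; exists i0, l0; split=> // i' l' /(pair_index ep)[|[_ ->]]; first exact: h6.
by rewrite (negbTE lU).
Qed.

Lemma best_so_far_keep (i : 'I_n) (l : 'I_m) (p : nat) s :
  p = (i * m + l)%N -> l \in unassigned phi ->
  s (addr 0 12) * card_int i l - cost_int i l * s (addr 0 13) <= 0 ->
  best_so_far p s -> best_so_far p.+1 s.
Proof.
move=> ep lU + hb; have d0 := card_int_gt0 i lU.
case: hb => [[h1 -> ->]|[i0 [l0 [h1 h2 h3 [h4 h5] h6]]]]; first by rewrite mulr0; lia.
rewrite h4 h5 subr_le0 => le; right; exists i0, l0.
by split=> // i' l' /(pair_index ep)[|[-> ->]] //; apply: h6.
Qed.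

Lemma best_so_far_update (i : 'I_n) (l : 'I_m) (p : nat) s s' :
  p = (i * m + l)%N -> l \in unassigned phi ->
  0 < s (addr 0 12) * card_int i l - cost_int i l * s (addr 0 13) ->
  s' (addr 0 10) = Posz (val i) -> s' (addr 0 11) = Posz (val l) ->
  s' (addr 0 12) = cost_int i l -> s' (addr 0 13) = card_int i l ->
  best_so_far p s -> best_so_far p.+1 s'.
Proof.
move=> ep lU hlt e0 e1 e2 e3 hb; right; exists i, l; split=> // i' l'.
case/(pair_index ep) => [h l'U|[-> ->]] //.
case: hb => [[h1 _ _]|[i0 [l0 [h1 h2 h3 [h4 h5] h6]]]]; first by rewrite (negbTE (h1 _ _ h)) in l'U.
have d0 := card_int_gt0 i0 h1; have d1 := card_int_gt0 i lU.
have := h6 _ _ h l'U; have d2 := card_int_gt0 i' l'U.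
(* Transitivity of the comparison of fractions, the three sizes being positive. *)
move: hlt; rewrite h4 h5 => hlt le; nia.
Qed.

End Search.

Lemma eval_opened s r phi e (i : 'I_n) : rep s r phi -> eval s e = i%:Z ->
  eval s (Read (cell 1 e)) = (i \in r : nat)%:Z.
Proof. by move=> hr he; rewrite -(rep_opened hr) -(eval_cell 1 he). Qed.

Lemma eval_assigned s r phi e (j : 'I_m) : rep s r phi -> eval s e = j%:Z ->
  eval s (Read (cell 2 e)) = assign_code phi j.
Proof. by move=> hr he; rewrite /assign_code -(rep_assigned hr) -(eval_cell 2 he). Qed.

Lemma assign_code_gt0 phi j : (0 < assign_code phi j) = (j \notin unassigned phi).
Proof. by rewrite inE /assign_code; case: (phi j). Qed.

Lemma delayed_ok s r phi (i : 'I_n) : env s -> rep s r phi -> s (addr 0 5) = i%:Z ->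
  wp b (If (Read (cell 1 (reg 5))) (put 8 (Const 0))
        (put 8 (Add (scaled (reg 5)) (Mul (reg 2) (reg 3))))) 2
    (fun s' => [/\ frame [:: 8] s s', small b s' & s' (addr 0 8) = delayed_int r phi i]) s.
Proof.
move=> he hr h5; have hs := env_small he.
have hi := eval_opened (e := reg 5) hr h5.
have /andP[d0 d1] := delayed_int_bound r phi i; have sb := star_bound i.
have d2 : delayed_int r phi i < (2 ^ b)%N%:Z.
  have /andP[_] := partial_sum_le m set0 (conn_int_ge0 i).
  by rewrite partial_sumT big_set0; lra.
have post v : v = delayed_int r phi i -> [/\ frame [:: 8] s (update s (addr 0 8) v),
    small b (update s (addr 0 8) v) &
    update s (addr 0 8) v (addr 0 8) = delayed_int r phi i].
  move=> ->; split; last by rewrite updE.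
    by apply: frame_update => //; apply: frame_refl.
  by apply: small_update => //; apply: absz_lt.
apply: wp_if => //; rewrite hi => hh; apply: wp_store => //; apply: post.
  by rewrite /delayed_int; move: hh; case: ifP.
rewrite /delayed_int; move: hh; case: ifP => // _ _.
rewrite -[LHS]/(eval s (scaled (reg 5)) + s (addr 0 2) * s (addr 0 3)).
by rewrite (eval_scaled (e := reg 5) (p := i) he h5) (env_D he) (rep_unassigned hr).
Qed.

Lemma search_body_ok s r phi (i : 'I_n) (l : 'I_m) (p : nat) :
  env s -> rep s r phi -> s (addr 0 14) = p -> p = (i * m + l)%N ->
  best_so_far r phi p s ->
  wp b search_body (m * 7 + 13) (fun s' => [/\ frame (iota 5 9) s s', small b s' &
    best_so_far r phi p.+1 s']) s.
Proof.
move=> he hr h14 ep hb; have hs := env_small he.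
have m0 : (0 < m)%N by apply: leq_ltn_trans (ltn_ord l).
have ei : (p %/ m)%N = i by rewrite ep divnMDl // divn_small // addn0.
have il : (i < 2 ^ b)%N by have := ltn_ord i; lia.
have ll : (l < 2 ^ b)%N by have := ltn_ord l; lia.
(* The step count is put in the shape that [wp_seq] and [wp_if] consume. *)
rewrite (_ : (m * 7 + 13 = 1 + (1 + (2 + (1 + (1 + ((m * 7).+1 + 5)))).+1))%N); last by lia.
apply: wp_seq; apply: wp_store => //=.
rewrite h14 (env_m he) divz_nat ei.
set s2 := update _ _ _.
have hs2 : small b s2 by apply: small_update.
have e2 : [/\ s2 (addr 0 14) = p, s2 (addr 0 5) = i%:Z & s2 (addr 0 1) = m].
  by rewrite /s2 !updE //= (env_m he).
apply: wp_seq; apply: wp_store => //=; case: e2 => -> -> ->.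
have -> : Posz p - i%:Z * m%:Z = l by rewrite ep; lia.
set s3 := update _ _ _.
have hs3 : small b s3 by apply: small_update.
have f3 : frame [:: 5; 6] s s3.
  by do 2!apply: frame_update => //; apply: frame_refl.
have he3 : env s3 by apply: env_frame f3 hs3 he.
have hr3 : rep s3 r phi by apply: rep_frame f3 hr.
have h35 : s3 (addr 0 5) = i by rewrite /s3 /s2 !updE.
have h36 : s3 (addr 0 6) = l by rewrite /s3 /s2 !updE.
have hb3 : best_so_far r phi p s3.
  by apply: best_so_far_frame hb; apply: frame_sub f3.
(* The body of [s3] is forgotten, so that later goals see only the recorded facts. *)
move: s3 hs3 f3 he3 hr3 h35 h36 hb3 => s3 hs3 f3 he3 hr3 h35 h36 hb3.
have f3' : frame (iota 5 9) s s3 by apply: frame_sub f3.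
apply: wp_if => //; rewrite (eval_assigned (e := reg 6) hr3 h36).
  rewrite assign_code_gt0 => lU; apply: wp_skip => //.
  by split=> //; apply: best_so_far_skip ep lU hb3.
rewrite leNgt assign_code_gt0 negbK => lU.
apply: wp_seq; apply: wp_weaken (leqnn _) _ (delayed_ok he3 hr3 h35) => s4 [f4 hs4 h48].
apply: wp_seq; apply: wp_store => //; apply: wp_seq.
rewrite [eval _ _]/= [eval _ _]/=; set s5 := update _ _ _.
have hs5 : small b s5 by apply: small_update; rewrite ?exp2_gt0.
apply: wp_store => //; rewrite [eval _ _]/= [eval _ _]/=; set s6 := update _ _ _.
have hs6 : small b s6 by apply: small_update; rewrite ?exp2_gt0.
have f6 : frame [:: 7; 8; 9] s3 s6.
  by do 2!apply: frame_update => //; apply: frame_sub f4.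
have he6 : env s6 by apply: env_frame f6 hs6 he3.
have hr6 : rep s6 r phi by apply: rep_frame f6 hr3.
have [h67 h68 h69] : [/\ s6 (addr 0 7) = 0, s6 (addr 0 8) = delayed_int r phi i &
    s6 (addr 0 9) = 0] by rewrite /s6 /s5 !updE.
have h65 : s6 (addr 0 5) = i by rewrite f6.2.
have h66 : s6 (addr 0 6) = l by rewrite f6.2.
move: s6 hs6 f6 he6 hr6 h67 h68 h69 h65 h66 => s6 hs6 f6 he6 hr6 h67 h68 h69 h65 h66.
apply: wp_seq; apply: wp_weaken (leqnn _) _
  (sum_star_ok he6 hr6 h65 h66 h67 h68 h69 (delayed_int_bound r phi i)).
move=> s7 [f7 hs7 h78 h79].
have {}f7 : frame [:: 7; 8; 9] s3 s7 by apply: frame_trans f6 f7.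
have hb7 : best_so_far r phi p s7.
  by apply: best_so_far_frame hb3; apply: frame_sub f7.
have f7' : frame (iota 5 9) s s7.
  by apply: frame_trans f3' _; apply: frame_sub f7.
have test : eval s7 (Defs.Sub (Mul (reg 12) (reg 9)) (Mul (reg 8) (reg 13))) =
    s7 (addr 0 12) * card_int phi i l - cost_int r phi i l * s7 (addr 0 13).
  by rewrite /= h78 h79.
apply: wp_if => //; rewrite test; last first.
  move=> hle; apply: wp_skip => //; split=> //.
  exact: best_so_far_keep ep lU hle hb7.
move=> hlt.
have h75 : s7 (addr 0 5) = i by rewrite f7.2.
have h76 : s7 (addr 0 6) = l by rewrite f7.2.
have c2 := cost_int_bound r phi i l; have c3 := card_int_le phi i l.
apply: (wp_seq (N := 1) (N' := 3)); apply: wp_store => //=; rewrite h75.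
set s8 := update _ _ _; have hs8 : small b s8 by apply: small_update.
have f8 : frame [:: 10] s7 s8 by apply: frame_update => //; apply: frame_refl.
apply: (wp_seq (N := 1) (N' := 2)); apply: wp_store => //=; rewrite f8.2 // h76.
set s9 := update _ _ _; have hs9 : small b s9 by apply: small_update.
have f9 : frame [:: 10; 11] s7 s9.
  by apply: frame_update => //; apply: frame_sub f8.
apply: (wp_seq (N := 1) (N' := 1)); apply: wp_store => //=; rewrite f9.2 // h78.
rewrite -/(cost_int r phi i l).
set s10 := update _ _ _; have hs10 : small b s10.
  by apply: small_update => //; case/andP: c2; apply: absz_lt.
have f10 : frame [:: 10; 11; 12] s7 s10.
  by apply: frame_update => //; apply: frame_sub f9.
apply: wp_store => //=; rewrite f10.2 // h79.
rewrite -/(card_int phi i l).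
set s11 := update _ _ _; have hs11 : small b s11.
  by apply: small_update => //; move: c3; rewrite /card_int; lia.
have f11 : frame [:: 10; 11; 12; 13] s7 s11.
  by apply: frame_update => //; apply: frame_sub f10.
split=> //.
  by apply: frame_trans f7' _; apply: frame_sub f11.
apply: (best_so_far_update ep lU hlt _ _ _ _ hb7).
all: by rewrite /s11 ?/s10 ?/s9 ?/s8 !updE.
Qed.

Lemma search_ok s r phi : env s -> rep s r phi -> unassigned phi != set0 -> (0 < n)%N ->
  wp b search (n * m * (m * 7 + 15) + 4) (fun s' => [/\ frame (iota 5 10) s s', small b s' &
    exists i l, [/\ best_star I r phi i l, s' (addr 0 10) = Posz (val i) &
      s' (addr 0 11) = Posz (val l)]]) s.
Proof.
move=> he hr U0 n0; have hs := env_small he.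
rewrite (_ : (n * m * (m * 7 + 15) + 4 = 1 + (1 + (1 + (n * m * (m * 7 + 13 + 1).+1).+1)))%N);
  last by lia.
have v1 : (`|1| < 2 ^ b)%N by lia.
have v0 : (`|0| < 2 ^ b)%N by lia.
apply: wp_seq; apply: wp_store => //.
apply: wp_seq; apply: wp_store => //; first exact: small_update.
apply: wp_seq; apply: wp_store => //; first by do 2!apply: small_update => //.
rewrite ![eval _ _]/=; set s1 := update _ _ _.
have hs1 : small b s1 by do 3!apply: small_update => //.
have f1 : frame (iota 5 10) s s1 by do 3!apply: frame_update => //; apply: frame_refl.
pose inv p s' := [/\ frame (iota 5 10) s s', small b s', s' (addr 0 14) = p%:Z &
  best_so_far r phi p s'].
apply: (wp_weaken (leqnn _) (Q := inv (n * m)%N)).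
  move=> s' [f' hs' _ hb]; split=> //; case: hb.
    (* The fraction 1/0 cannot survive: an unassigned l was met in row 0, where its pair has index l
       < n m. *)
    case=> h; move: U0 => /set0Pn[l lU].
    have := h (Ordinal n0) l; rewrite lU /= mul0n add0n => /(_ _)/negP[] //.
    by apply: leq_trans (ltn_ord l) _; rewrite leq_pmull.
  case=> i [l [lU h10 h11 [_ _] h]]; exists i, l; split=> //.
  apply: best_star_int => // i' l' l'U; apply: h => //.
  by have := ltn_ord i'; have := ltn_ord l'; nia.
apply: wp_for => //.
- by move=> k s' [].
- move=> k s' [f' hs' e _] /=; rewrite e.
  have he' : env s' by apply: env_frame f' hs' he.
  by rewrite (env_n he') (env_m he').
- move=> p s' pk [f' hs' e hb].
  have he' : env s' by apply: env_frame f' hs' he.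
  have hr' : rep s' r phi by apply: rep_frame f' hr.
  have m0 : (0 < m)%N by case: (posnP m) pk => // ->; rewrite muln0.
  have hi : (p %/ m < n)%N by rewrite ltn_divLR.
  have hl : (p %% m < m)%N by rewrite ltn_mod.
  have ep : p = (Ordinal hi * m + Ordinal hl)%N by rewrite /= -divn_eq.
  apply: wp_seq; apply: wp_weaken (leqnn _) _ (search_body_ok he' hr' e ep hb).
  move=> s2 [f2 hs2 hb2]; apply: wp_store => //=.
  rewrite f2.2 // e -PoszD addn1.
  split.
  + by apply: frame_update => //; apply: frame_trans f' _; apply: frame_sub f2.
  + by apply: small_update => //; lia.
  + by rewrite updE.
  + apply: best_so_far_frame hb2; apply: frame_update => //; exact: frame_refl.
- by split=> //; left; split.
Qed.

Lemma env_update s q k v : (q < 4)%N -> (q == 0%N) && (k < 3)%N = false ->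
  (`|v| < 2 ^ b)%N -> env s -> env (update s (addr q k) v).
Proof.
move=> q4 hk hv [e0 e1 e2 e3 e4].
have h j : (j < 3)%N -> update s (addr q k) v (addr 0 j) = s (addr 0 j).
  move=> j3; rewrite updE //; case: ifP => // /andP[/eqP e /eqP ejk].
  by rewrite -e -ejk j3 in hk.
split; rewrite ?h //; exact: small_update.
Qed.

Lemma rep_put s r phi k v : (4 < k)%N -> rep s r phi -> rep (update s (addr 0 k) v) r phi.
Proof.
move=> k4; apply: (@rep_frame [:: k]); first by rewrite /= k4.
apply: frame_update; [exact: mem_head|exact: frame_refl].
Qed.

Lemma rep_ext s r phi phi' : phi =1 phi' -> rep s r phi -> rep s r phi'.
Proof.
move=> e [h0 h1 h2 h3 h4]; split=> //; first by move=> j; rewrite h1 e.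
by rewrite h3; congr (Posz _); apply: eq_card => j; rewrite !inE e.
Qed.

Lemma uniq_size_le r : uniq r -> (size r <= n)%N.
Proof. by move=> /card_uniqP <-; rewrite -[X in (_ <= X)%N](card_ord n) max_card. Qed.

Lemma open_facility_ok s r phi (i : 'I_n) (l : 'I_m) : env s -> rep s r phi -> uniq r ->
  s (addr 0 10) = i -> s (addr 0 11) = l ->
  wp b open_facility 4 (fun s' => [/\ env s', rep s' (next_route r i) phi,
    s' (addr 0 10) = i & s' (addr 0 11) = l]) s.
Proof.
move=> he hr ur h10 h11; have hs := env_small he.
have hi := eval_opened (e := reg 10) hr h10.
have sr := uniq_size_le ur; have lt_i := ltn_ord i.
apply: wp_if => //; rewrite hi /next_route; case: ifP => // ir _.
  by apply: wp_skip.
have ec : eval s (cell 1 (reg 10)) = addr 1 i by apply: eval_cell.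
apply: (wp_seq (N := 1) (N' := 2)); apply: wp_store => //; rewrite ec [eval _ _]/=.
set s1 := update _ _ _; have he1 : env s1 by apply: env_update => //; lia.
have h14 : s1 (addr 0 4) = (size r)%:Z by rewrite /s1 updE //= (rep_size hr).
have ec1 : eval s1 (cell 3 (reg 4)) = addr 3 (size r) by apply: eval_cell.
apply: (wp_seq (N := 1) (N' := 1)); apply: wp_store => //; first exact: env_small.
have h110 : s1 (addr 0 10) = i by rewrite /s1 updE.
rewrite ec1 [eval _ _]/= h110.
set s2 := update _ _ _; have he2 : env s2 by apply: env_update => //; lia.
have h24 : s2 (addr 0 4) = (size r)%:Z by rewrite /s2 updE.
apply: wp_store => //; first exact: env_small.
rewrite [eval _ _]/= [eval _ _]/= h24 -PoszD addn1.
split; [by apply: env_update => //; lia| |by rewrite /s2 /s1 !updE|by rewrite /s2 /s1 !updE].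
split=> [i'|j|k||].
- rewrite /s2 /s1 !updE //= mem_rcons inE (rep_opened hr) val_eqE.
  by case: (i' == i).
- by rewrite /s2 /s1 !updE //= (rep_assigned hr).
- rewrite size_rcons ltnS leq_eqVlt /s2 /s1 !updE //= map_rcons nth_rcons size_map.
  by case: ltngtP => //= h _; rewrite (rep_route hr).
- by rewrite /s2 /s1 !updE //= (rep_unassigned hr).
- by rewrite updE //= size_rcons.
Qed.

(** In the middle of [assign_star] the memory represents this hybrid of the old and the new
    assignment. *)
Definition mix_assign phi phi' (k : nat) : 'I_m -> option 'I_n :=
  fun j => if (j < k)%N then phi' j else phi j.

Lemma mix_assignS phi phi' (j k : 'I_m) :
  mix_assign phi phi' j.+1 k = if k == j then phi' k else mix_assign phi phi' j k.
Proof.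
rewrite /mix_assign ltnS; case: eqVneq => [->|ne]; first by rewrite leqnn.
by rewrite leq_eqVlt (inj_eq val_inj) (negbTE ne).
Qed.

Lemma mix_assign_eq phi phi' (j : 'I_m) : mix_assign phi phi' j j = phi j.
Proof. by rewrite /mix_assign ltnn. Qed.

Lemma assign_star_ok s r phi (i : 'I_n) (l : 'I_m) : env s -> rep s r phi ->
  s (addr 0 10) = i -> s (addr 0 11) = l ->
  wp b assign_star (m * 7 + 2) (fun s' => env s' /\ rep s' r (next_assign I phi i l)) s.
Proof.
move=> he hr h10 h11; have hs := env_small he.
set phi' := next_assign I phi i l.
rewrite (_ : (m * 7 + 2 = 1 + (m * 7).+1)%N); last by lia.
apply: wp_seq; apply: wp_store => //=; set s1 := update _ _ _.
pose inv k s := [/\ env s, rep s r (mix_assign phi phi' k), s (addr 0 7) = k,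
  s (addr 0 10) = i & s (addr 0 11) = l].
apply: (wp_weaken (leqnn _) (Q := inv m)).
  move=> s' [he' hr' _ _ _]; split=> //; apply: rep_ext hr' => j.
  by rewrite /mix_assign ltn_ord.
apply: (for_star_ok (N := 2) (i := i) (l := l) (phi := phi)) => //.
- move=> k s' [he' hr' e7 e10 e11]; split=> // j kj.
  by rewrite (rep_assigned hr') /mix_assign ltnNge kj.
- move=> j s' [he' hr' e7 e10 e11] jS; have lt_j := ltn_ord j; have lt_i := ltn_ord i.
  have jU := subsetP (star_sub I phi i l) j jS.
  have ec : eval s' (cell 2 (reg 7)) = addr 2 j by apply: eval_cell.
  have hs' := env_small he'.
  apply: (wp_seq (N := 1) (N' := 1)); apply: wp_store => //; rewrite ec [eval _ _]/= e10.
  rewrite -PoszD addn1; set s2 := update _ _ _.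
  have he2 : env s2 by apply: env_update => //; lia.
  have cU : #|unassigned (mix_assign phi phi' j)| =
      #|unassigned (mix_assign phi phi' j.+1)|.+1.
    rewrite (cardsD1 j) inE mix_assign_eq; move: jU; rewrite inE => -> /=.
    rewrite add1n; congr _.+1; apply: eq_card => k; rewrite !inE mix_assignS.
    by have [->|//] := eqVneq k j; rewrite /phi' /next_assign jS.
  have e3 : s2 (addr 0 3) = #|unassigned (mix_assign phi phi' j)| .
    by rewrite /s2 updE //= (rep_unassigned hr').
  have le_m : (#|unassigned (mix_assign phi phi' j)| <= m)%N.
    by rewrite -[X in (_ <= X)%N](card_ord m) max_card.
  apply: wp_store => //; first exact: env_small.
  rewrite [eval _ _]/= [eval _ _]/= e3 cU (_ : forall c : nat, Posz c.+1 - 1 = c); last by lia.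
  set s3 := update _ _ _.
  have he3 : env s3 by apply: env_update => //; lia.
  split; [by rewrite /s3 /s2 !updE|exact: env_small|split].
  + by apply: env_update => //; lia.
  + apply: rep_put => //; split=> [i'|k|k kr||].
    * by rewrite /s3 /s2 !updE //= (rep_opened hr').
    * rewrite /s3 /s2 !updE //= (rep_assigned hr') mix_assignS (inj_eq val_inj).
      by have [->|//] := eqVneq k j; rewrite /phi' /next_assign jS.
    * by rewrite /s3 /s2 !updE //= (rep_route hr').
    * by rewrite /s3 /s2 !updE.
    * by rewrite /s3 /s2 !updE //= (rep_size hr').
  + by rewrite updE.
  + by rewrite /s3 /s2 !updE.
  + by rewrite /s3 /s2 !updE.
- move=> j s' [he' hr' e7 e10 e11] jS; have lt_j := ltn_ord j; split.
  + by apply: env_update => //; lia.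
  + apply: rep_put => //; apply: rep_ext hr' => k; rewrite mix_assignS.
    have [->|//] := eqVneq k j.
    by rewrite mix_assign_eq /phi' /next_assign (negbTE jS).
  + by rewrite updE.
  + by rewrite updE.
  + by rewrite updE.
- split; [|apply: rep_put => //|by rewrite /s1 updE..].
  by apply: env_update => //; rewrite exp2_gt0.
Qed.

(** Register 3, the number of unassigned clients, is both the loop test and the variant, so there
    are at most m rounds. The levels a and tau are ghost state, which the program never computes. *)
Lemma greedy_ok s : (0 < n)%N -> env s -> rep s [::] (fun=> None) ->
  wp b greedy (m * (n * m * (m * 7 + 15) + 4 + (4 + (m * 7 + 2))).+1).+1
    (fun s' => env s' /\ exists r phi a tau,
       [/\ rep s' r phi, greedy_inv I r phi a tau & unassigned phi = set0]) s.
Proof.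
move=> n0 he hr.
pose inv k s := env s /\ exists r phi a tau,
  [/\ rep s r phi, greedy_inv I r phi a tau & #|unassigned phi| = k].
apply: (wp_while (inv := inv)) => //.
- by move=> k s' [/env_small].
- move=> k s' [he' [r [phi [a [tau [hr' hg hk]]]]]] hpos.
  have [U0|U0] := eqVneq (unassigned phi) set0.
    by move: hpos; rewrite /= (rep_unassigned hr') U0 cards0.
  apply: wp_seq; apply: wp_weaken (leqnn _) _ (search_ok he' hr' U0 n0).
  move=> s1 [f1 hs1 [i [l [hb h10 h11]]]].
  have he1 : env s1 by apply: env_frame f1 hs1 he'.
  have hr1 : rep s1 r phi by apply: rep_frame f1 hr'.
  apply: wp_seq; apply: wp_weaken (leqnn _) _
    (open_facility_ok he1 hr1 (inv_uniq hg) h10 h11) => s2 [he2 hr2 h210 h211].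
  apply: wp_weaken (leqnn _) _ (assign_star_ok he2 hr2 h210 h211) => s3 [he3 hr3].
  exists #|unassigned (next_assign I phi i l)|.
    by rewrite -hk; case: hb => lU _; apply: unassigned_next_lt.
  have [a' [tau' hg']] := greedy_inv_step metricI hg hb.
  by split=> //; exists (next_route r i), (next_assign I phi i l), a', tau'.
- move=> k s' [he' [r [phi [a [tau [hr' hg hk]]]]]] h.
  split=> //; exists r, phi, a, tau; split=> //; apply/eqP; rewrite -cards_eq0.
  by move: h; rewrite /= (rep_unassigned hr') lez_nat leqn0.
- split=> //; exists [::], (fun=> None), (fun=> 0), 0; split=> //.
    exact: greedy_inv_init.
  by rewrite (_ : unassigned _ = setT) ?cardsT ?card_ord //; apply/setP => j; rewrite !inE.
Qed.

(** * Writing the output and reading the input *)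

Definition output r (h : 'I_m -> 'I_n) : seq int :=
  (size r)%:Z :: [seq (val i)%:Z | i <- r] ++ [seq (val (h j))%:Z | j <- enum 'I_m].

Lemma size_output r h : size (output r h) = (1 + size r + m)%N.
Proof. by rewrite /output -cat1s !size_cat !size_map -enumT size_enum_ord addnA. Qed.

Lemma nth_output_route r h k : (k < size r)%N ->
  nth 0 (output r h) k.+1 = (nth 0%N (map val r) k)%:Z.
Proof.
move=> kr; rewrite /= nth_cat size_map kr map_comp (nth_map 0%N) //.
by rewrite size_map.
Qed.

Lemma nth_output_assign r h (j : 'I_m) : nth 0 (output r h) (1 + size r + j) = (h j)%:Z.
Proof.
rewrite /output -cat1s -addnA nth_cat ltnNge leq_addr addKn /=.
rewrite nth_cat size_map ltnNge leq_addr /= addKn.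
by rewrite (nth_map j) ?size_enum_ord // nth_ord_enum.
Qed.

(** [frame] would protect the input cells, which the output phase overwrites; here only negative
    cells other than register 7 are preserved. *)
Definition negative_frame s s' := forall q k, (q < 4)%N ->
  ~~ ((q == 0%N) && (k == 7)%N) -> s' (addr q k) = s (addr q k).

Lemma negative_frame_put s s' v :
  negative_frame s s' -> negative_frame s (update s' (addr 0 7) v).
Proof. by move=> hf q k q4 hk; rewrite updE // (negbTE hk) hf. Qed.

Lemma negative_frame_pos s s' (t : nat) v :
  negative_frame s s' -> negative_frame s (update s' t v).
Proof. by move=> hf q k q4 hk; rewrite -hf. Qed.

Definition written (out : seq int) (c : nat) s := forall t : nat, (t < c)%N ->
  s t = nth 0 out t.

Lemma writtenS out c s v : written out c s -> v = nth 0 out c ->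
  written out c.+1 (update s c v).
Proof.
move=> h ->; move=> t; rewrite ltnS /update eqz_nat leq_eqVlt.
by case: eqVneq => [->|_] //= /h.
Qed.

Lemma epilogue_ok s r phi (h : 'I_m -> 'I_n) :
  env s -> rep s r phi -> uniq r -> (forall j, phi j = Some (h j)) ->
  wp b epilogue (n * 3 + m * 3 + 5) (fun s' => shows s' (output r h)) s.
Proof.
move=> he hr ur hphi; have hs := env_small he; have sr := uniq_size_le ur.
set out := output r h.
rewrite (_ : (n * 3 + m * 3 + 5 = 1 + (1 + ((n * 3).+1 + (1 + (m * 3).+1))))%N);
  last by lia.
apply: wp_seq; apply: wp_store => //; rewrite [eval _ _]/= [eval _ _]/= (rep_size hr).
set s1 := update _ _ _; have hs1 : small b s1 by apply: small_update => //; lia.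
have f1 : negative_frame s s1 by apply: negative_frame_pos.
have w1 : written out 1 s1 by apply: writtenS.
apply: wp_seq; apply: wp_store => //; rewrite [eval _ _]/= [eval _ _]/=.
set s2 := update _ _ _.
have hs2 : small b s2 by apply: small_update; rewrite ?exp2_gt0.
have f2 : negative_frame s s2 by apply: negative_frame_put.
have w2 : written out 1 s2 by [].
(* The offset c is 1 in the loop that writes the route and 1 + [size r] in the loop that writes the
   assignment. *)
pose inv c k s' := [/\ negative_frame s s', small b s', s' (addr 0 7) = Posz k &
  written out (c + k) s'].
have i2 : inv 1%N 0%N s2 by split=> //; rewrite /s2 updE.
apply: wp_seq; apply: (wp_weaken (N := (size r * 3).+1) (Q := inv 1%N (size r))).
- by lia.
- move=> s3 [f3 hs3 _ w3]; apply: wp_seq; apply: wp_store => //.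
  rewrite [eval _ _]/= [eval _ _]/=; set s4 := update _ _ _.
  have i4 : inv (1 + size r)%N 0%N s4.
    split; [exact: negative_frame_put| |by rewrite /s4 updE|by rewrite addn0].
    by apply: small_update; rewrite ?exp2_gt0.
  apply: (wp_weaken (leqnn _) (Q := inv (1 + size r)%N m)).
    by move=> s5 [_ _ _ w5] t; rewrite size_output; apply: w5.
  apply: wp_for => //.
  + by move=> k s' [].
  + by move=> k s' [f' _ e7 _]; rewrite /= e7 f' // (env_m he).
  + move=> k s' km [f' hs' e7 w']; pose j := Ordinal km; have lt_h := ltn_ord (h j).
    have eA : eval s' (Add (Add (Const 1) (reg 4)) (reg 7)) = (1 + size r + k)%N.
      by rewrite /= e7 f' // (rep_size hr).
    have eV : eval s' (Read (cell 2 (reg 7))) = (h j).+1.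
      rewrite -[LHS]/(s' (eval s' (cell 2 (reg 7)))) (@eval_cell _ 2 (reg 7) j) //.
      by rewrite f' // (rep_assigned hr) hphi.
    apply: (wp_seq (N := 1) (N' := 1)); apply: wp_store => //.
    rewrite eA -[eval _ (Defs.Sub _ _)]/(eval s' (Read (cell 2 (reg 7))) - 1) eV.
    rewrite (_ : Posz (h j).+1 - 1 = h j); last by lia.
    set s5 := update _ _ _; have hs5 : small b s5 by apply: small_update => //; lia.
    have e57 : s5 (addr 0 7) = k by rewrite -e7.
    apply: wp_store => //; rewrite [eval _ _]/= [eval _ _]/= e57 -PoszD addn1.
    split.
    * by apply/negative_frame_put/negative_frame_pos.
    * by apply: small_update => //; lia.
    * by rewrite updE.
    * by rewrite addnS; apply: writtenS => //; rewrite (nth_output_assign _ _ j).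
- apply: wp_for => //.
  + by move=> k s' [].
  + by move=> k s' [f' _ e7 _]; rewrite /= e7 f' // (rep_size hr).
  + move=> k s' kr [f' hs' e7 w'].
    have eV : eval s' (Read (cell 3 (reg 7))) = (nth 0%N (map val r) k)%:Z.
      rewrite -[LHS]/(s' (eval s' (cell 3 (reg 7)))) (@eval_cell _ 3 (reg 7) k) //.
      by rewrite f' // (rep_route hr).
    apply: (wp_seq (N := 1) (N' := 1)); apply: wp_store => //.
    rewrite [eval _ (Add _ _)]/= e7 -PoszD.
    set s5 := update _ _ _.
    have hs5 : small b s5 by apply: small_update => //; apply: hs'.
    have e57 : s5 (addr 0 7) = k by rewrite -e7.
    apply: wp_store => //; rewrite [eval _ _]/= [eval _ _]/= e57 -PoszD addn1.
    split.
    * by apply/negative_frame_put/negative_frame_pos.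
    * by apply: small_update => //; lia.
    * by rewrite updE.
    * by rewrite addnS; apply: writtenS => //; rewrite eV add1n nth_output_route.
Qed.

Lemma prologue_ok : nth 0 w 0 = n -> nth 0 w 1 = m ->
  (forall p, (p < n + n * m)%N -> 0 < den w p) -> D = den_prod w (n + n * m) ->
  D < (2 ^ b)%N%:Z -> small b (load w) ->
  wp b prologue ((n + n * m) * 3 + 5) (fun s => env s /\ rep s [::] (fun=> None)) (load w).
Proof.
move=> wn wm den_gt0 eD ltD hs.
have n_lt : (n < 2 ^ b)%N by lia.
have m_lt : (m < 2 ^ b)%N by lia.
rewrite (_ : ((n + n * m) * 3 + 5 = 1 + (1 + (1 + (((n + n * m) * 3).+1 + 1))))%N);
  last by lia.
apply: wp_seq; apply: wp_store => //; rewrite [eval _ _]/= [eval _ _]/= wn.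
set s1 := update _ _ _; have hs1 : small b s1 by apply: small_update.
have v1 : eval s1 (Read (Const 1)) = m by rewrite -wm.
apply: wp_seq; apply: wp_store => //; rewrite v1 [eval _ _]/=.
set s2 := update _ _ _; have hs2 : small b s2 by apply: small_update.
apply: wp_seq; apply: wp_store => //; rewrite [eval _ _]/= [eval _ _]/=.
set s3 := update _ _ _; have hs3 : small b s3 by apply: small_update => //; lia.
pose inv k s := [/\ frame [:: 0; 1; 2; 14] (load w) s, small b s,
  s (addr 0 14) = Posz k, s (addr 0 2) = den_prod w k &
  s (addr 0 0) = n /\ s (addr 0 1) = m].
have i0 : inv 0%N s3.
  split=> //.
    by do 3!apply: frame_update => //; apply: frame_refl.
  by rewrite /s3 updE //= /den_prod big_nil.
apply: wp_seq; apply: (wp_weaken (leqnn _) (Q := inv (n + n * m)%N)); last first.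
  apply: wp_for => //.
  - by move=> k s [].
  - by move=> k s [_ _ h14 _ [h0 h1]]; rewrite /= h14 h0 h1 PoszD PoszM.
  move=> k s kN [f hs' h14 h2 [h0 h1]].
  have [d0 dle] : 0 < den_prod w k.+1 /\ den_prod w k.+1 <= D.
    by apply/andP; rewrite eD; apply: den_prod_mono.
  have ek : (k < 2 ^ b)%N by lia.
  have eV : eval s (Mul (reg 2) (Read (Add (Const 3) (Mul (Const 2) (reg 14))))) =
      den_prod w k.+1.
    rewrite /= h14 h2 -!(PoszM, PoszD) f.1 /= -/(den w k).
    by rewrite /den_prod big_nat_recr.
  apply: (wp_seq (N := 1) (N' := 1)); apply: wp_store => //; rewrite eV [eval _ _]/=.
  set s4 := update _ _ _; have hs4 : small b s4.
    by apply: small_update => //; apply: absz_lt; lia.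
  have e4 : s4 (addr 0 14) = k by rewrite /s4 updE.
  apply: wp_store => //; rewrite [eval _ _]/= [eval _ _]/= e4 -PoszD addn1.
  split; last by rewrite /s4 !updE.
  - by do 2!apply: frame_update => //.
  - by apply: small_update => //; lia.
  - by rewrite updE.
  - by rewrite /s4 !updE.
move=> s [f hs' h14 h2 [h0 h1]].
apply: wp_store => //; rewrite [eval _ _]/= [eval _ _]/= h1.
have hs4 : small b (update s (addr 0 3) m) by apply: small_update.
split; first split=> //.
- by rewrite updE //= h2 eD.
- by move=> k; rewrite upd_pos f.1.
split=> // [i|j||].
- by rewrite updE //= f.2.
- by rewrite updE //= f.2.
- have -> : unassigned (fun=> None : option 'I_n) = setT :> {set 'I_m}.
    by apply/setP => j; rewrite !inE.
  by rewrite updE //= cardsT card_ord.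
- by rewrite updE //= f.2.
Qed.

Lemma solver_ok : (0 < n)%N -> nth 0 w 0 = n -> nth 0 w 1 = m ->
  (forall p, (p < n + n * m)%N -> 0 < den w p) -> D = den_prod w (n + n * m) ->
  D < (2 ^ b)%N%:Z -> small b (load w) ->
  wp b solver ((n + n * m) * 3 + 5 +
    ((m * (n * m * (m * 7 + 15) + 4 + (4 + (m * 7 + 2))).+1).+1 + (n * 3 + m * 3 + 5)))
    (fun s => exists S : solution n m, shows s (solution_code S) /\
       forall z, lp_feasible z -> cost I S <= 27 / 5 * lp_value I z) (load w).
Proof.
move=> n0 wn wm den_gt0 eD ltD hs.
apply: wp_seq; apply: wp_weaken (leqnn _) _ (prologue_ok wn wm den_gt0 eD ltD hs).
move=> s1 [he1 hr1]; apply: wp_seq.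
apply: wp_weaken (leqnn _) _ (greedy_ok n0 he1 hr1).
move=> s2 [he2 [r [phi [a [tau [hr2 hg U0]]]]]].
have hphi j : exists i, phi j == Some i.
  have /negbT : j \in unassigned phi = false by rewrite U0 inE.
  by rewrite inE; case: (phi j) => // i _; exists i.
pose h j := xchoose (hphi j).
have eh j : phi j = Some (h j) by apply/eqP/(xchooseP (hphi j)).
have [S [eS1 eS2 hS]] := greedy_inv_final metricI hg eh.
apply: wp_weaken (leqnn _) _ (epilogue_ok he2 hr2 (inv_uniq hg) eh) => s3 hs3.
exists S; split=> //; move: hs3; rewrite /output /solution_code eS1 eS2 ?enumT.
exact.
Qed.

End Verification.

(** * The LP optimum and the approximation ratio *)

From mathcomp Require Import all_classical all_reals all_analysis.

Lemma lp_value_ge0 (R : realType) n m (I : mlufl R n m) (z : lp_point R n m) :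
  metric_mlufl I -> lp_feasible z -> 0 <= lp_value I z.
Proof.
case=> f0 c0 _ [_ _ _ x0 y0]; apply: addr_ge0.
  by do 2!(apply: sumr_ge0 => ? _); rewrite mulr_ge0.
by do 3!(apply: sumr_ge0 => ? _); rewrite mulr_ge0 ?addr_ge0.
Qed.

Lemma sum_eq_ord (R : pzSemiRingType) (n k : nat) (kn : (k < n)%N) (g : 'I_n -> R) :
  \sum_(t < n) g t * (k == t)%:R = g (Ordinal kn).
Proof.
rewrite (bigD1 (Ordinal kn)) //= eqxx mulr1 big1 ?addr0 // => t.
by rewrite -val_eqE /= eq_sym => /negbTE ->; rewrite mulr0.
Qed.

(** [lp_opt] is an infimum, and bounding it from below requires a feasible point: facility i is
    opened in slot i and serves every client there. *)
Lemma lp_feasible_exists (R : realType) n m :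
  (0 < n)%N -> exists z : lp_point R n m, lp_feasible z.
Proof.
move=> n0; exists (LPPoint (fun i _ t => (val i == val t)%:R) (fun i t => (val i == val t)%:R)).
have s1 (t : 'I_n) : \sum_(i < n) (val t == val i)%:R = 1 :> R.
  rewrite -[RHS](sum_eq_ord (ltn_ord t) (fun=> 1 : R)).
  by apply: eq_bigr => i _; rewrite mul1r.
split=> //= [j|t].
  rewrite (eq_bigr (fun=> 1)) => [|i _]; last by rewrite -[RHS](s1 i).
  by rewrite sumr_const card_ord ler1n.
by rewrite -[leRHS](s1 t); apply: ler_sum => i _; rewrite eq_sym.
Qed.

Lemma lp_opt_ge (R : realType) n m (I : mlufl R n m) (x k : R) :
  (0 < n)%N -> 0 < k -> (forall z, lp_feasible z -> x <= k * lp_value I z) ->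
  x <= k * lp_opt I.
Proof.
move=> n0 k0 h; rewrite mulrC -ler_pdivrMr //; apply: lb_le_inf.
  by have [z hz] := lp_feasible_exists R m n0; exists (lp_value I z), z.
by move=> _ [z hz <-]; rewrite ler_pdivrMr // mulrC h.
Qed.

Lemma lp_opt_ge0 (R : realType) n m (I : mlufl R n m) :
  (0 < n)%N -> metric_mlufl I -> 0 <= lp_opt I.
Proof.
move=> n0 hI; rewrite -[lp_opt I]mul1r; apply: lp_opt_ge => // z hz.
by rewrite mul1r lp_value_ge0.
Qed.

(** The 0/1 point that makes the LP a relaxation. The membership factor in y matters: the [index] of
    an absent facility is [size (route S)], which may be a genuine slot. *)
Definition solution_point (R : realType) n m (S : solution n m) : lp_point R n m :=
  LPPoint (fun i j t => (i == assign S j)%:R * (index i (route S) == t)%:R)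
          (fun i t => (i \in route S)%:R * (index i (route S) == t)%:R).

Lemma index_route_lt n m (S : solution n m) i :
  i \in route S -> (index i (route S) < n)%N.
Proof.
move=> iS; apply: (@leq_trans (size (route S))); first by rewrite index_mem.
by have := max_card (mem (route S)); rewrite card_ord (card_uniqP _) ?route_uniq.
Qed.

Lemma solution_point_feasible (R : realType) n m (S : solution n m) :
  lp_feasible (solution_point R S).
Proof.
split=> /=.
- move=> j; rewrite (bigD1 (assign S j)) //= eqxx.
  rewrite (sum_eq_ord (index_route_lt (assign_opened S j))) lerDl.
  by do 2!(apply: sumr_ge0 => ? _); rewrite mulr_ge0.
- move=> i j t; rewrite ler_wpM2r //.
  by have [->|_] := eqVneq i (assign S j); rewrite ?assign_opened.
- move=> t; have [/hasP[i0 i0S /eqP e0]|/hasPn h] :=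
    boolP (has (fun i => index i (route S) == t) (route S)).
    rewrite (bigD1 i0) //= big1 ?addr0.
      by rewrite i0S e0 eqxx mulr1.
    move=> i ne; have [iS|] := boolP (i \in route S); last by rewrite mul0r.
    case: eqP => [e|_]; last by rewrite mulr0.
    by case/eqP: ne; rewrite -(nth_index i0 iS) e -e0 nth_index.
  rewrite big1 // => i _; have [/h/negbTE ->|_] := boolP (i \in route S).
    by rewrite mulr0.
  by rewrite mul0r.
- by move=> i j t; rewrite mulr_ge0.
- by move=> i t; rewrite mulr_ge0.
Qed.

Lemma solution_point_value (R : realType) n m (I : mlufl R n m) (S : solution n m) :
  lp_value I (solution_point R S) = cost I S.
Proof.
congr (_ + _).
  rewrite [RHS](big_uniq _ (route_uniq S)) [RHS]big_mkcond; apply: eq_bigr => i _.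
  have [iS|/negbTE iS] := boolP (i \in route S).
    rewrite (eq_bigr (fun t : 'I_n => open_cost I i * (index i (route S) == t)%:R)).
      by rewrite (sum_eq_ord (index_route_lt iS)).
    by move=> t _; rewrite /= iS mul1r.
  by rewrite big1 // => t _; rewrite /= iS mul0r mulr0.
apply: eq_bigr => j _; rewrite (bigD1 (assign S j)) //= eqxx.
under eq_bigr do rewrite mul1r.
rewrite (sum_eq_ord (index_route_lt (assign_opened S j))) big1 ?addr0 // => i /negbTE ne.
by rewrite big1 // => t _; rewrite ne mul0r mulr0.
Qed.

Lemma lp_opt_le_cost (R : realType) n m (I : mlufl R n m) (S : solution n m) :
  metric_mlufl I -> lp_opt I <= cost I S.
Proof.
move=> hI; apply: ge_inf.
  by exists 0 => _ [z hz <-]; apply: lp_value_ge0.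
exists (solution_point R S); [exact: solution_point_feasible|exact: solution_point_value].
Qed.

(** The last term of the maximum suffices: a < 1 gives 4 / a > 4 and a ceiling of at least 2. *)
Lemma approx_ratio_ge8 (R : realType) (a b : R) : 0 < a < 1 -> 8 <= approx_ratio a b.
Proof.
move=> /andP[a0 a1]; rewrite /approx_ratio !le_max; apply/orP; right; apply/orP; right.
have c2 : 2 <= (Num.ceil (1 / a))%:~R :> R.
  have : (1%:Z < Num.ceil (1 / a)) by rewrite ceil_gt_int ltr_pdivlMr // mul1r.
  by rewrite -lezD1 -[2]/(2%:~R) ler_int.
apply: (@le_trans _ _ (4 / a * 2)); last by rewrite ler_wpM2l // divr_ge0 // ltW.
by rewrite mulrAC ler_pdivlMr //; lra.
Qed.

(** * Numerical estimates for the ratio 10.773 *)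

Lemma series_le_expR (R : realType) (x : R) k : 0 <= x ->
  \sum_(0 <= i < k) x ^+ i / i`!%:R <= expR x.
Proof.
move=> x0; apply: nondecreasing_cvgn_le (is_cvg_series_exp_coeff x) _.
by apply: nondecreasing_series => i _ _; apply: exp_coeff_ge0.
Qed.

Lemma expRD_ge (R : realType) (x y p q r : R) : 0 <= p -> 0 <= q ->
  r <= p * q -> p <= expR x -> q <= expR y -> r <= expR (x + y).
Proof. by move=> p0 q0 h hp hq; rewrite expRD (le_trans h) // ler_pM. Qed.

Lemma expR1_ge (R : realType) : 299 / 110 <= expR 1 :> R.
Proof.
apply: le_trans (@series_le_expR R 1 8 ler01).
by rewrite !big_nat_recr //= big_nil !expr1n /factorial /=; lra.
Qed.

Lemma expR_7727_ge (R : realType) : 433 / 200 <= expR (7727 / 10 ^+ 4) :> R.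
Proof.
have x0 : 0 <= 7727 / 10 ^+ 4 :> R by lra.
apply: le_trans (series_le_expR 6 x0) => {x0}.
by rewrite !big_nat_recr //= big_nil /factorial /=; lra.
Qed.

(** Lower bounds for e, e^2, e^4, e^5 and e^10 are built by multiplication, each rounded down to a
    short fraction so that the arithmetic stays small. *)
Lemma expR_107727_ge (R : realType) :
  22 * 10 ^+ 3 * (433 / 200) <= expR (10%:R + 7727 / 10 ^+ 4) :> R.
Proof.
apply: expRD_ge (lexx _) _ (expR_7727_ge R); [lra|lra|].
rewrite (_ : 10 = 1 + 1 + (1 + 1) + 1 + (1 + 1 + (1 + 1) + 1)); last by lra.
have e2 : 628 / 85 <= expR (1 + 1) :> R.
  by apply: (expRD_ge _ _ _ (expR1_ge R) (expR1_ge R)); lra.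
have e4 : 1037 / 19 <= expR (1 + 1 + (1 + 1)) :> R.
  by apply: (expRD_ge _ _ _ e2 e2); clear e2; lra.
have e5 : 445 / 3 <= expR (1 + 1 + (1 + 1) + 1) :> R.
  by apply: (expRD_ge _ _ _ e4 (expR1_ge R)); clear e2 e4; lra.
by apply: (expRD_ge _ _ _ e5 e5); clear e2 e4 e5; lra.
Qed.

Lemma approx_ratio_10773 (R : realType) :
  approx_ratio (7426 / 10 ^+ 4 : R) (21 / 10 ^+ 6) <= 10 + 773 / 10 ^+ 3.
Proof.
rewrite /approx_ratio !ge_max; apply/and3P; split.
- rewrite ler_pdivrMr; last by lra.
  rewrite -ler_expR lnK ?posrE; last by rewrite div1r invr_gt0; lra.
  (* The inverse of beta is about 47619.05 and the middle term is 47630; the exponent 10.7727 lies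
     just below 10.773 (1 - beta), about 10.77277. *)
  apply: (@le_trans _ _ (22 * 10 ^+ 3 * (433 / 200))); first by rewrite div1r; lra.
  by apply: le_trans (expR_107727_ge R) _; rewrite ler_expR; lra.
- have h1 : 3 / (1 - 21 / 10 ^+ 6) <= 3001 / 10 ^+ 3 :> R by rewrite ler_pdivrMr; lra.
  have h2 : 2 / (1 - 7426 / 10 ^+ 4) <= 7771 / 10 ^+ 3 :> R by rewrite ler_pdivrMr; lra.
  by apply: le_trans (lerD h1 h2) _; clear; lra.
- have -> : Num.ceil (1 / (7426 / 10 ^+ 4) : R) = 2.
    by apply: ceil_def; apply/andP; split; lra.
  lra.
Qed.

(** * Encoded instances *)

Lemma nth_allpairs (T1 T2 T : Type) (f : T1 -> T2 -> T) x1 x2 x0 s t k l :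
  (k < size s)%N -> (l < size t)%N ->
  nth x0 [seq f x y | x <- s, y <- t] (k * size t + l) = f (nth x1 s k) (nth x2 t l).
Proof.
elim: s k => // x s IH [|k] hk hl; rewrite allpairs_cons nth_cat size_map.
  by rewrite hl (nth_map x2).
by rewrite mulSn -addnA ltnNge leq_addr /= addKn IH.
Qed.

Section InstanceCode.
Context {n m : nat} (I : mlufl rat n m).

Definition costs : seq rat :=
  [seq open_cost I i | i <- enum 'I_n] ++
  [seq conn_cost I i j | i <- enum 'I_n, j <- enum 'I_m].

Lemma size_costs : size costs = (n + n * m)%N.
Proof. by rewrite size_cat size_map size_allpairs -!cardE !card_ord. Qed.

Lemma nth_costs_open (i : 'I_n) : nth 0 costs i = open_cost I i.
Proof.
by rewrite nth_cat size_map -cardE card_ord ltn_ord (nth_map i) ?nth_ord_enum //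
  -cardE card_ord.
Qed.

Lemma nth_costs_conn (i : 'I_n) (j : 'I_m) : nth 0 costs (n + i * m + j) = conn_cost I i j.
Proof.
rewrite nth_cat size_map -cardE card_ord -addnA ltnNge leq_addr /= addKn.
have := @nth_allpairs _ _ _ (conn_cost I) i j 0 (enum 'I_n) (enum 'I_m) i j.
by rewrite -!cardE !card_ord !nth_ord_enum => ->.
Qed.

Lemma mlufl_codeE : mlufl_code I = [:: n%:Z, m%:Z & flatten (map rat_code costs)].
Proof.
rewrite /mlufl_code map_cat flatten_cat -map_comp; do 2!congr (_ :: _).
by congr (_ ++ flatten _); rewrite map_allpairs.
Qed.

Lemma nth_rat_codes (s : seq rat) p : (p < size s)%N ->
  nth 0 (flatten (map rat_code s)) (2 * p) = numq (nth 0 s p) /\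
  nth 0 (flatten (map rat_code s)) (2 * p).+1 = denq (nth 0 s p).
Proof.
by elim: s p => // q s IH [|p] // /IH h; rewrite mulnS.
Qed.

Lemma nth_code_num p : (p < n + n * m)%N ->
  nth 0 (mlufl_code I) (2 + 2 * p) = numq (nth 0 costs p).
Proof. by rewrite -size_costs mlufl_codeE => /nth_rat_codes[]. Qed.

Lemma nth_code_den p : (p < n + n * m)%N ->
  nth 0 (mlufl_code I) (3 + 2 * p) = denq (nth 0 costs p).
Proof. by rewrite -size_costs mlufl_codeE => /nth_rat_codes[]. Qed.

Lemma size_code : size (mlufl_code I) = (2 + 2 * (n + n * m))%N.
Proof.
rewrite mlufl_codeE /= -size_costs; congr _.+2; elim: costs => //= q s ->.
by rewrite mulnS.
Qed.

End InstanceCode.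

Lemma ltn_bits z : (`|z| < 2 ^ bits z)%N.
Proof. by rewrite /bits; apply: trunc_log_ltn. Qed.

Lemma size_le_code_size w : (size w <= code_size w)%N.
Proof.
rewrite /code_size -sum1_size; exact: leq_sum.
Qed.

Lemma nth_code_size (w : seq int) k : (`|nth 0%R w k| < 2 ^ code_size w)%N.
Proof.
case: (ltnP k (size w)) => [kw|kw]; last by rewrite nth_default // exp2_gt0.
apply: leq_trans (ltn_bits _) _; rewrite leq_exp2l // /code_size.
by rewrite (big_rem (nth 0 w k)) ?mem_nth //= leq_addr.
Qed.

(** The length of the product of all denominators is at most the sum of their lengths, which is part
    of the input length; so the plain product serves as common denominator. *)
Lemma den_prod_le (w : seq int) k : size w = (2 + 2 * k)%N ->
  (`|den_prod w k| <= 2 ^ code_size w)%N.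
Proof.
move=> sw; have : (`|den_prod w k| <= 2 ^ \sum_(0 <= p < k) bits (den w p))%N.
  elim: k {sw} => [|k IH]; first by rewrite /den_prod !big_nil.
  rewrite /den_prod !big_nat_recr //= abszM expnD leq_mul //.
  exact: ltnW (ltn_bits _).
move/leq_trans; apply; rewrite leq_exp2l // /code_size [X in (_ <= X)%N](big_nth 0) sw.
elim: k {sw} => [|k IH]; first by rewrite big_nil.
rewrite mulnS !addSn add0n [X in (X <= _)%N]big_nat_recr //.
rewrite [X in (_ <= X)%N]big_nat_recr // [X in (_ <= X + _)%N]big_nat_recr //= -addnA.
by apply: leq_add IH _; rewrite leq_addl.
Qed.

(** * The solver on an encoded rational instance *)

Section Decoding.
Context {R : realType} {n m : nat} (I : mlufl rat n m).

Lemma real_mlufl_metric : metric_mlufl I -> metric_mlufl (real_mlufl R I).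
Proof.
case=> f0 c0 [d [d0 drefl dC dt de]]; split=> [i|i j|]; try by rewrite ler0q.
exists (fun u v => ratr (d u v)); split=> [u v|u|u v|u v x|i j].
- by rewrite ler0q.
- by rewrite drefl rmorph0.
- by rewrite dC.
- by rewrite -rmorphD ler_rat.
- by rewrite de.
Qed.

Let w := mlufl_code I.
Let L := code_size w.
Let D := den_prod w (n + n * m).

Lemma den_code_gt0 p : (p < n + n * m)%N -> 0 < den w p.
Proof. by move=> hp; rewrite /den nth_code_den. Qed.

Lemma dvd_den_prod (p : nat) : (p < n + n * m)%N -> (den w p %| D)%Z.
Proof.
move=> hp; rewrite /D /den_prod (big_cat_nat (n := p)) ?(ltnW hp) //=.
by rewrite [X in _ * X](big_ltn hp) mulrCA dvdz_mulr.
Qed.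

Lemma scaled_cost_ratr (p : nat) : (p < n + n * m)%N ->
  (scaled_cost w D p)%:~R = D%:~R * ratr (nth 0 (costs I) p) :> R.
Proof.
move=> hp; rewrite /scaled_cost nth_code_num //.
have := dvd_den_prod hp; rewrite /den nth_code_den // => /divzK h.
rewrite -{2}h /ratr !rmorphM /= [RHS]mulrAC mulrCA mulrA [LHS]mulrC.
by rewrite mulfVK ?intr_eq0 ?denq_neq0 // mulrC.
Qed.

Lemma scaled_cost_bound p : (p < n + n * m)%N -> (`|scaled_cost w D p| <= 2 ^ (2 * L))%N.
Proof.
move=> hp; rewrite /scaled_cost abszM (mul2n L) -addnn expnD leq_mul //.
  exact: ltnW (nth_code_size _ _).
apply: leq_trans (leq_absz_div _ _) _; exact: (den_prod_le (size_code I)).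
Qed.

Lemma code_size_lb : (2 + 2 * (n + n * m) <= L)%N.
Proof. by rewrite -(size_code I) size_le_code_size. Qed.

(** The code has an entry for each of the n + n m costs, so n, m and n m are all at most L. The
    dominant term, m rounds over n m pairs with O(m) work each, is therefore cubic in L. *)
Lemma solver_time : (0 < n)%N ->
  (((n + n * m) * 3 + 5 +
    ((m * (n * m * (m * 7 + 15) + 4 + (4 + (m * 7 + 2))).+1).+1 + (n * 3 + m * 3 + 5)))
   <= 63 * L ^ 3)%N.
Proof.
move=> n0; have hL := code_size_lb.
have h1 : (n <= L)%N by lia.
have h2 : (n * m <= L)%N by lia.
have h3 : (m <= L)%N by nia.
have h4 : (1 <= L)%N by lia.
have h5 : (m * 7 + 15 <= 22 * L)%N by lia.
have h6 : (n * m * (m * 7 + 15) <= 22 * L ^ 2)%N.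
  by rewrite (_ : 22 * L ^ 2 = L * (22 * L))%N ?leq_mul //; nia.
have h7 : (L <= L ^ 2)%N by rewrite -[X in (X <= _)%N]expn1 leq_pexp2l.
have h8 : (L ^ 2 <= L ^ 3)%N by rewrite leq_pexp2l.
have h9 : ((n * m * (m * 7 + 15) + 4 + (4 + (m * 7 + 2))).+1 <= 40 * L ^ 2)%N by lia.
have h10 : (m * (n * m * (m * 7 + 15) + 4 + (4 + (m * 7 + 2))).+1 <= 40 * L ^ 3)%N.
  by rewrite (_ : 40 * L ^ 3 = L * (40 * L ^ 2))%N ?leq_mul // (expnS _ 2) mulnCA.
lia.
Qed.

Lemma solver_run : (0 < n)%N -> metric_mlufl I ->
  exists (T : nat) (s : memory) (S : solution n m),
    [/\ exec solver (load w) T s, (T <= 63 * (2000 * 4) * L ^ 4)%N,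
        shows s (solution_code S) &
        forall z, lp_feasible z -> cost (real_mlufl R I) S <= 27 / 5 * lp_value (real_mlufl R I) z].
Proof.
move=> n0 hI; have hL := code_size_lb.
have hIR := real_mlufl_metric hI.
(* Numerators and the common denominator are at most 2^L, so scaled costs are at most 2^(2 L). A
   star adds at most m + 2 such terms, and m + 2 < 2^(2 L). *)
pose b := (4 * L)%N.
have b8 : (8 <= b)%N by lia.
have LX := ltn_expl L (isT : (1 < 2)%N).
have /andP[D0 _] : 0 < D <= D := den_prod_mono den_code_gt0 (leqnn _).
have Dle : (`|D| <= 2 ^ L)%N by apply: (den_prod_le (size_code I)).
have Fs (i : 'I_n) : (open_int w D i)%:~R = D%:~R * open_cost (real_mlufl R I) i.
  rewrite /open_int scaled_cost_ratr ?nth_costs_open //.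
  by rewrite (leq_trans (ltn_ord i)) // leq_addr.
have idx (i : 'I_n) (j : 'I_m) : (n + i * m + j < n + n * m)%N.
  by have := ltn_ord i; have := ltn_ord j; nia.
have Cs (i : 'I_n) (j : 'I_m) :
    (@conn_int n m w D i j)%:~R = D%:~R * conn_cost (real_mlufl R I) i j.
  by rewrite /conn_int scaled_cost_ratr ?nth_costs_conn.
have e1 : (L <= 2 ^ L)%N by apply: ltnW.
have e2 : (2 ^ b = 2 ^ (2 * L) * 2 ^ (2 * L))%N by rewrite -expnD; congr (_ ^ _)%N; lia.
have e3 : (2 ^ (2 * L) = 2 ^ L * 2 ^ L)%N by rewrite -expnD; congr (_ ^ _)%N; lia.
have m_le : (m <= n * m)%N by rewrite leq_pmull.
have ib : (n + m + n * m + 2 < 2 ^ b)%N by nia.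
have sb (i : 'I_n) : open_int w D i + D * m%:Z + \sum_(j < m) @conn_int n m w D i j < (2 ^ b)%N%:Z.
  have absz_le (x : int) (N : nat) : (`|x| <= N)%N -> x <= N%:Z by lia.
  have hF : open_int w D i <= (2 ^ (2 * L))%N%:Z.
    apply/absz_le/scaled_cost_bound.
    by rewrite (leq_trans (ltn_ord i)) // leq_addr.
  have hC : \sum_(j < m) @conn_int n m w D i j <= (m * 2 ^ (2 * L))%N%:Z.
    rewrite (@le_trans _ _ (\sum_(j < m) (2 ^ (2 * L))%N%:Z)) //.
      by apply: ler_sum => j _; apply/absz_le/scaled_cost_bound.
    by rewrite sumr_const card_ord -mulr_natr natz PoszM mulrC.
  have hD : D * m%:Z <= (2 ^ (2 * L))%N%:Z.
    rewrite e3 PoszM ler_pM //; first exact: ltW.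
      exact: absz_le.
    by rewrite lez_nat; lia.
  have h1 : (2 + m < 2 ^ (2 * L))%N by nia.
  have h2 : (2 ^ (2 * L) + 2 ^ (2 * L) + m * 2 ^ (2 * L) < 2 ^ b)%N.
    by rewrite e2 addnn -mul2n -mulnDl ltn_mul2r expn_gt0.
  move: hF hC hD h2; lia.
have hD : D < (2 ^ b)%N%:Z by nia.
have hs : small b (load w).
  case=> k; last by rewrite /= expn_gt0.
  by apply: leq_trans (nth_code_size _ _) _; rewrite leq_exp2l // /b; lia.
have w0 : nth 0 w 0 = n by [].
have w1 : nth 0 w 1 = m by [].
have := solver_ok hIR D0 Fs Cs b8 ib sb n0 w0 w1 den_code_gt0 (erefl D) hD hs.
move=> [T [s [hex hT [S [hshow hS]]]]].
exists T, s, S; split=> //; apply: leq_trans hT _.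
apply: (@leq_trans (63 * L ^ 3 * (2000 * b))%N).
  by rewrite leq_mul2r solver_time ?orbT.
by rewrite /b (expnSr L 3) !mulnA leq_eqVlt; apply/orP; left; apply/eqP; ring.
Qed.

End Decoding.

Lemma solver_poly_time (R : realType)
    (good : forall n m : nat, mlufl rat n m -> solution n m -> Prop) :
  (forall n m (I : mlufl rat n m) (S : solution n m), (0 < n)%N -> metric_mlufl I ->
     (forall z, lp_feasible z ->
        cost (real_mlufl R I) S <= 27 / 5 * lp_value (real_mlufl R I) z) ->
     good n m I S) ->
  poly_time_solver solver good.
Proof.
move=> h; exists (63 * (2000 * 4))%N, 4%N => n m I n0 hI.
have [T [s [S [hex hT hshow hS]]]] := @solver_run R n m I n0 hI.
by exists T, s, S; split=> //; apply: h.
Qed.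

Theorem theorem2p14 (R : realType) :
  (forall alpha beta : R, 0 < alpha < 1 -> 0 < beta < 1 ->
     (forall (n m : nat) (I : mlufl R n m), (0 < n)%N -> metric_mlufl I ->
        exists S : solution n m, cost I S <= approx_ratio alpha beta * lp_opt I) /\
     (exists P : program,
        poly_time_solver P (fun (n m : nat) (I : mlufl rat n m) (S : solution n m) =>
          cost (real_mlufl R I) S <= approx_ratio alpha beta * lp_opt (real_mlufl R I)))) /\
  approx_ratio (7426 / 10 ^+ 4 : R) (21 / 10 ^+ 6) <= 10 + 773 / 10 ^+ 3 /\
  (exists P : program, approximation_algorithm (10 + 773 / 10 ^+ 3 : R) P).
Proof.
have bound (rho : R) n m (I : mlufl R n m) (S : solution n m) :
    8 <= rho -> (0 < n)%N -> metric_mlufl I ->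
    (forall z, lp_feasible z -> cost I S <= 27 / 5 * lp_value I z) ->
    cost I S <= rho * lp_opt I.
  move=> hrho n0 hI hS; apply: (@le_trans _ _ (27 / 5 * lp_opt I)).
    by apply: lp_opt_ge.
  by rewrite ler_wpM2r ?lp_opt_ge0 // (le_trans _ hrho) //; lra.
split; [|split; first exact: approx_ratio_10773].
  move=> alpha beta halpha _; have hrho := approx_ratio_ge8 beta halpha.
  split=> [n m I n0 hI|].
    by have [S hS] := greedy_solution n0 hI; exists S; apply: bound.
  (* One program serves all alpha and beta, because its factor 27/5 does not depend on them. *)
  exists solver; apply: (@solver_poly_time R) => n m I S n0 hI hS.
  by apply: bound => //; apply: real_mlufl_metric.
exists solver; apply: (@solver_poly_time R) => n m I S n0 hI hS S'.
have hIR := @real_mlufl_metric R n m I hI.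
have rho8 : 8 <= 10 + 773 / 10 ^+ 3 :> R by lra.
(* The cost of the competing solution replaces the LP optimum, which lies below it by relaxation. *)
apply: le_trans (bound _ _ _ _ _ rho8 n0 hIR hS) _.
by apply: ler_wpM2l; [lra|exact: lp_opt_le_cost].
Qed.
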